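(* Let $h=(h_i)_{i\ge 0}$ be a probability distribution on $\{0,1,2,\dots\}$ with $0<m_h:=\sum_{k\ge 1} k h_k<1$, and suppose that there exists $c>0$ such that $\sum_{l\ge k} h_l\le \exp\{-ck\}$ for each $k\in\mathbb{N}$. Let $\nu$ be a probability distribution on $(1,\infty)$ whose support is contained in $[q,Q]$ for some $Q>q>1$, and suppose that the $\mathbb{Z}$-linear span of $\{\log y: y\in \mathrm{supp}(\nu)\}$ is dense in $\mathbb{R}$. Let $\chi>0$ be the unique value satisfying $\int_1^\infty y^{\chi}\,\nu(dy)=1/m_h$. Then there exists a constant $d_1\in(0,\infty)$ such that $$\mathbb{P}_{h,\nu}\big(\omega(T)>u\big)\sim d_1 u^{-\chi}\qquad\text{as } u\to\infty .$$
   Context: Write $A(u)\sim B(u)$ if $A(u)/B(u)\to 1$ as $u\to\infty$. $T$ is a finite rooted tree with root $\phi$, vertex set $V(T)$ and edge set $E(T)$; it is weighted if each edge $e$ carries a number $\beta_e>1$ (its bias). For $v\in V(T)$, $\omega(v)$ is the product of the biases $\beta_e$ over the edges $e$ of the unique simple path from $\phi$ to $v$ (so $\omega(\phi)=1$), and $\omega(T)=\sum_{v\in V(T)}\omega(v)$. The law $\mathbb{P}_{h,\nu}$ is the law of a Galton-Watson tree $T$ with offspring distribution $h$ (each vertex has independently an $h$-distributed number of offspring), whose edges are equipped with biases $(\beta_e)_{e\in E(T)}$ that, given $T$, are i.i.d. with law $\nu$. *)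

(* Defs.v *)
From mathcomp Require Import all_boot all_order all_algebra.
From mathcomp Require Import all_classical all_reals all_analysis.

Set Implicit Arguments.
Unset Strict Implicit.
Unset Printing Implicit Defensive.

Import Order.TTheory GRing.Theory Num.Theory.
Import numFieldNormedType.Exports.

Local Open Scope classical_set_scope.
Local Open Scope ring_scope.

Definition asymp_equiv (R : realType) (A B : R -> R) : Prop :=
  A u / B u @[u --> +oo] --> (1 : R).

(* Closed support: the complement of the largest open null set. *)
Definition msupport (R : realType) (mu : probability R R) : set R :=
  [set x | forall U : set R, open U -> U x -> (0 < mu U)%E].

Definition int_span (R : realType) (A : set R) : set R :=
  [set x | exists s : seq (int * R),
    (forall p, p \in s -> A p.2) /\ x = \sum_(p <- s) p.2 *~ p.1].

(* m_h; h_k is h [set k] *)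
Definition offspring_mean (R : realType) (h : probability nat R) : \bar R :=
  (\sum_(1 <= k <oo) k%:R%:E * h [set k])%E.

(* Vertices are Ulam-Harris words: the root is [::] and the i-th child of v
   (counted from 0) is rcons v i. The pair (v, i) stands for the edge from v to
   rcons v i. *)
Definition vertex : Type := seq nat.
Definition edge : Type := (seq nat * nat)%type.

(* Vertex set of the tree in which v has n v children. The values of n outside
   the tree are irrelevant. *)
Definition tree_of (n : vertex -> nat) : set vertex :=
  [set v | forall j, (j < size v)%N -> (nth 0%N v j < n (take j v))%N].

(* omega(v): the j-th edge on the path from the root to v is
   (take j v, nth 0 v j). *)
Definition vertex_weight (R : realType) (b : edge -> R) (v : vertex) : R :=
  \prod_(j < size v) b (take j v, nth 0%N v j).

(* omega(T); extended-real because the tree of an arbitrary n may be infinite.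
   esum is the sum of a family only when its terms are nonnegative. *)
Definition tree_weight (R : realType) (n : vertex -> nat) (b : edge -> R) :
    \bar R :=
  \esum_(v in tree_of n) (vertex_weight b v)%:E.

(* Mutual independence of a family of classes of events (to be applied to
   sigma-algebras, which contain the full event). *)
Definition mutually_independent (R : realType) (d : measure_display)
    (Omega : measurableType d) (P : probability Omega R) (I : choiceType)
    (F : I -> set (set Omega)) : Prop :=
  forall (s : seq I) (E : I -> set Omega), uniq s ->
    (forall i, i \in s -> F i (E i)) ->
    P (\bigcap_(i in [set` s]) E i) = (\prod_(i <- s) P (E i))%E.

Definition sigma_of (d d' : measure_display) (Omega : measurableType d)
    (T : measurableType d') (X : Omega -> T) : set (set Omega) :=
  [set X @^-1` A | A in [set A : set T | measurable A]].

Definition has_law (R : realType) (d d' : measure_display)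
    (Omega : measurableType d) (T : measurableType d')
    (P : probability Omega R) (X : {RV P >-> T}) (mu : probability T R) : Prop :=
  forall A : set T, measurable A -> distribution P X A = mu A.

(* (N, beta) realizes the law P_{h,nu}: N v is the number of children of v and
   beta e the bias of e. Offspring numbers and biases are attached to all
   Ulam-Harris words and edges, and tree_of (N ^~ w) keeps those of the tree.
   As the biases are i.i.d. and independent of the offspring numbers, given the
   tree those of its edges are i.i.d. with law nu. *)
Record weighted_GW (R : realType) (h : probability nat R) (nu : probability R R)
    (d : measure_display) (Omega : measurableType d) (P : probability Omega R)
    (N : vertex -> {RV P >-> nat}) (beta : edge -> {RV P >-> R}) : Prop := {
  weighted_GW_offspring : forall v, has_law (N v) h ;
  weighted_GW_bias : forall e, has_law (beta e) nu ;
  weighted_GW_indep : mutually_independent P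
    (fun i : vertex + edge => match i with
       | inl v => sigma_of (N v)
       | inr e => sigma_of (beta e)
       end) }.

(* Main.v *)
Require Import Defs.
From HB Require Import structures.
From mathcomp Require Import all_boot all_order all_algebra.
From mathcomp Require Import all_classical all_reals all_analysis.
From mathcomp Require Import measurable_realfun.
From mathcomp Require Import ring lra.

Import Order.TTheory GRing.Theory Num.Theory.
Import numFieldNormedType.Exports.

Local Open Scope classical_set_scope.
Local Open Scope ring_scope.

Set Implicit Arguments.
Unset Strict Implicit.
Unset Printing Implicit Defensive.

(** Let W be the total weight of the tree and G u the probability that W > u.
    Decomposing the tree at its root gives W = 1 + sum_(i < N) B_i W_i, where N
    is the number of children of the root, B_i the bias of the edge to the i-th
    child, and W_i an independent copy of W. A large sum is due to a single
    large branch B_i W_i, so G u is close to m * g u, where m is the mean of h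
    and g u = E G (u / B) is the tail of one branch. On the logarithmic scale,
    f x = exp (chi * x) * G (exp x) is then close to F x = E f (x - X), where the
    step X = ln B is taken under the law nu tilted by m * y ^ chi, which is a
    probability by the choice of chi. Hence f almost solves a renewal equation,
    and the theorem says that f has a positive limit.

    The steps lie in [ln q, ln Q], and G is nonincreasing; with these two facts
    the convergence has a direct proof ([renewal_limit]). Let L be the limsup
    of f. If f x is close to L then f is close to L near x - s for each s in the
    support of X, since an average of values that hardly exceed L can only be
    close to L if most of them are ([recurrent_shift_step]). Iterating, s may be
    any element of the additive semigroup generated by the support, and far out
    this semigroup has arbitrarily small gaps, because the group it generates is
    dense ([semigroup_dense]). Since exp (- chi * x) * f x is nonincreasing, f is
    almost at least L on a whole window of length ln Q. The steps are too
    short to jump over this window, so the inequality f >= F - error carries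
    the bound to everything beyond it ([window_propagates]): the liminf
    of f is L as well. The same comparison, with the multiplicative form of the
    error, shows that L > 0 ([renewal_bounded_below]).

    The inequality f >= F - error is Bonferroni's inequality for the events that
    a branch exceeds u ([bonferroni], [tail_lower]). In the other direction, the
    weight exceeds u only if one branch exceeds nearly u or two branches exceed
    u^(3/4) / N ([one_or_two_branches], [tail_upper]); two branches are
    independent, so the second possibility costs the square of a tail. This
    square is negligible once G u = O(u^(-chi)) is known. A power bound with a
    small exponent comes from an induction on the height of the tree
    ([tail_init]), and each use of the upper inequality improves the exponent by
    a factor 5/4 until it reaches chi ([growth_step]).

    On the side of probability, all offspring numbers and biases are collected
    in one random configuration, whose law is determined by h and nu
    ([realizes_unique]); therefore G, and with it the limit, is the same on all
    probability spaces ([tree_weight_law]). The same uniqueness shows that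
    resampling some coordinates of a configuration from an independent copy does
    not change its law ([realizes_mix]), which reduces the independence of
    the branches to the theorem of Fubini ([independent_events],
    [ebranch_tailE]). *)

(** * Exponential bounds and induction along the real line *)

Lemma expRN_small (R : realType) (a c : R) : 0 < a -> 0 < c ->
  exists2 x0 : R, 0 <= x0 & forall x, x0 <= x -> expR (- (a * x)) <= c.
Proof.
move=> a0 c0; exists (Num.max 0 (- ln c / a)); first by rewrite le_max lexx.
move=> x; rewrite ge_max => /andP[_ xc].
rewrite -[leRHS](lnK (x := c)) ?posrE// ler_expR.
by rewrite lerNl mulrC -ler_pdivrMr.
Qed.

Lemma expR_le_1D2x (R : realType) (s : R) : 0 <= s <= 1 / 2 ->
  expR s <= 1 + 2 * s.
Proof.
move=> /andP[s0 s2]; have h := expR_ge1Dx (- s).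
rewrite expRN in h; have e0 := expR_gt0 s.
have : expR s * (1 - s) <= 1.
  by rewrite -[leRHS](mulfV (lt0r_neq0 e0)) ler_pM2l//.
move=> h2; suff : (1 + 2 * s) * (1 - s) >= 1 by nra.
by nra.
Qed.

(** From any point of the half-line, finitely many steps of length [a] lead
    below [x1]. *)
Lemma scale_ind (R : realType) (a l x1 : R) (S : R -> Prop) : 0 < a ->
  (forall x : R, l <= x <= x1 -> S x) ->
  (forall x : R, x1 < x -> (forall w : R, l <= w <= x - a -> S w) -> S x) ->
  forall x : R, l <= x -> S x.
Proof.
move=> a0 base step.
have H n : forall x, l <= x <= x1 + a * n%:R -> S x.
  elim: n => [|n IH] x; first by rewrite mulr0 addr0; exact: base.
  move=> /andP[lx xn]; case: (leP x x1) => [xx1|x1x].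
    by apply: base; rewrite lx.
  apply: step => // w /andP[lw wx]; apply: IH; rewrite lw/=.
  by rewrite (le_trans wx)// lerBlDr -addrA -[X in _ + (_ + X)]mulr1 -mulrDr natr1.
move=> x lx; pose n := (Num.truncn `|(x - x1) / a|).+1.
apply: (H n); rewrite lx -lerBlDl mulrC -ler_pdivrMr//.
by rewrite (le_trans (ler_norm _))// ltW// truncnS_gt.
Qed.

Lemma expR_le_1D (R : realType) (s : R) : expR s <= 1 + s * expR s.
Proof.
have h1 := expR_ge1Dx (- s); have s0 := expR_gt0 s.
have : expR s * (1 - s) <= expR s * expR (- s) by rewrite ler_pM2l.
by rewrite -expRD subrr expR0; lra.
Qed.

(** * Shifts that preserve closeness to the upper limit *)

(** With [L] the limsup of [f] at infinity: whenever [f] is almost at its upper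
    limit at a far point, it is so again near the point shifted back by [s].
    The precision [d] needed at the far point may depend on the precision [e]
    wanted at the other one, which makes the property stable under addition of
    shifts. *)
Definition recurrent_shift (R : realType) (f : R -> R) (L s : R) : Prop :=
  forall e : R, 0 < e -> exists2 d : R, 0 < d & exists U : R,
    forall x : R, U <= x -> L - d <= f x ->
      exists2 z : R, `|z - (x - s)| <= e & L - e <= f z.

Lemma recurrent_shift0 (R : realType) (f : R -> R) (L : R) :
  recurrent_shift f L 0.
Proof.
move=> e e0; exists e => //; exists 0 => x _ Lx; exists x => //.
by rewrite subr0 subrr normr0 ltW.
Qed.

Lemma recurrent_shiftD (R : realType) (f : R -> R) (L s t : R) :
  recurrent_shift f L s -> recurrent_shift f L t -> recurrent_shift f L (s + t).
Proof.
move=> gs gt e e0; have e20 : 0 < e / 2 by lra.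
have [d d0 [U HU]] := gt _ e20.
have m0 : 0 < Num.min d (e / 2) by rewrite lt_min d0.
have [d' d'0 [U' HU']] := gs _ m0; exists d' => //.
exists (Num.max U' (U + s + e)) => x; rewrite ge_max => /andP[xU' xU] Lx.
have [z zx Lz] := HU' x xU' Lx.
have [md me] : Num.min d (e / 2) <= d /\ Num.min d (e / 2) <= e / 2.
  by rewrite !ge_min !lexx orbT.
move: zx; rewrite ler_norml => /andP[z1 z2].
have [] := HU z; [lra|lra|].
move=> y; rewrite ler_norml => /andP[y1 y2] Ly.
by exists y; [rewrite ler_norml; apply/andP; split; lra|lra].
Qed.

(** For finitely many shifts, one precision serves them all. *)
Lemma recurrent_shift_seq (R : realType) (f : R -> R) (L e : R) (r : seq R) :
  0 < e -> (forall s, s \in r -> recurrent_shift f L s) ->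
  exists2 d : R, 0 < d & exists U : R,
    forall x s : R, s \in r -> U <= x -> L - d <= f x ->
      exists2 z : R, `|z - (x - s)| <= e & L - e <= f z.
Proof.
move=> e0; elim: r => [|s r IH] rec; first by exists 1 => //; exists 0.
have [d d0 [U HU]] := IH (fun t tr => rec t (mem_behead (s := s :: r) tr)).
have [d' d'0 [U' HU']] := rec s (mem_head _ _) _ e0.
exists (Num.min d d'); first by rewrite lt_min d0.
exists (Num.max U U') => x t tsr; rewrite ge_max => /andP[xU xU'] Lx.
have [md md'] : Num.min d d' <= d /\ Num.min d d' <= d'.
  by rewrite !ge_min !lexx orbT.
move: tsr; rewrite inE => /predU1P[->|tr].
  by apply: HU' => //; lra.
by apply: (HU _ _ tr) => //; lra.
Qed.

(** The terms with positive and those with negative coefficients are collected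
    separately. *)
Lemma int_span_diff (R : realType) (A : set R) (S : R -> Prop) (z : R) :
  S 0 -> (forall s t, S s -> S t -> S (s + t)) -> (forall s, A s -> S s) ->
  int_span A z -> exists s t : R, [/\ S s, S t & z = s - t].
Proof.
move=> S0 SD SA [r [rA ->]]; elim: r rA => [|p r IH] rA.
  by exists 0, 0; rewrite big_nil subrr.
have [s [t [Ss St E]]] := IH (fun q qr => rA q (mem_behead (s := p :: r) qr)).
have Ap := SA _ (rA p (mem_head _ _)).
have SM n : S (p.2 *+ n) by elim: n => [//|n ih]; rewrite mulrS; apply: SD.
rewrite big_cons E; case: p.1 => n.
  by exists (p.2 *+ n + s), t; split => //; [exact: SD|rewrite addrA].
exists s, (p.2 *+ n.+1 + t); split => //; first exact: SD.
by rewrite NegzE mulrNz opprD addrCA.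
Qed.

(** If the group generated by [A] is dense, it contains a small [z > 0], a
    difference [s1 - s2] of two elements of the semigroup. The points
    [s2 * k + z * j = s2 * (k - j) + s1 * j] with [j <= k] are in the semigroup
    and progress by steps of [z] from [s2 * k]; when [k] exceeds [s2 / z] they
    reach [s2 * k.+1], so that from then on there is no gap longer than [z]. *)
Lemma semigroup_dense (R : realType) (A : set R) (S : R -> Prop) (eta B : R) :
  (forall s, A s -> 0 < s) -> dense (int_span A) ->
  S 0 -> (forall s t, S s -> S t -> S (s + t)) -> (forall s, A s -> S s) ->
  0 < eta -> 0 <= B ->
  exists T : R, exists2 r : seq R, (forall s, s \in r -> S s) &
    forall t : R, T <= t <= T + B -> exists2 s : R, s \in r & s <= t < s + eta.
Proof.
move=> A_gt0 dA S0 SD SA eta0 B0.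
have [z [/=]] : `]0, eta[%classic `&` int_span A !=set0.
  apply: dA; last exact: interval_open.
  by exists (eta / 2) => /=; rewrite in_itv/=; apply/andP; split; lra.
rewrite in_itv/= => /andP[z0 z_eta] zA.
(* adding [a] to both terms makes [s2] positive *)
have [a Aa] : exists a, A a.
  case: zA => -[|p r] [rA zE]; first by move: z0; rewrite zE big_nil ltxx.
  by exists p.2; apply: rA; rewrite mem_head.
pose S' s := S s /\ 0 <= s.
have [s [t [[Ss s0] [St t0] zE]]] : exists s t, [/\ S' s, S' t & z = s - t].
  apply: int_span_diff zA; first by split.
    by move=> s t [Ss s0] [St t0]; split; [exact: SD|exact: addr_ge0].
  by move=> s As; split; [exact: SA|exact: ltW (A_gt0 _ As)].
pose s1 := s + a; pose s2 := t + a.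
have a0 := A_gt0 _ Aa; have s20 : 0 < s2 by rewrite /s2; lra.
have zE' : z = s1 - s2 by rewrite /s1 /s2 zE; lra.
have Ss1 : S s1 by apply: SD => //; exact: SA.
have Ss2 : S s2 by apply: SD => //; exact: SA.
have SM u n : S u -> S (u *+ n).
  by move=> Su; elim: n => [//|n ih]; rewrite mulrS; apply: SD.
clearbody s1 s2.
pose k0 := (Num.truncn (s2 / z)).+1; pose T := s2 * k0%:R.
pose n := (Num.truncn ((T + B) / s2)).+1.
exists T, [seq s2 *+ (k - j) + s1 *+ j | k <- iota 0 n, j <- iota 0 n].
  by move=> u /allpairsP[[k j] [_ _ ->]]; apply: SD; exact: SM.
move=> x /andP[Tx xB].
have T0 : 0 <= T by rewrite mulr_ge0 ?ltW.
have q0 : 0 <= x / s2 by rewrite divr_ge0 ?(ltW s20)//; lra.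
pose k := Num.truncn (x / s2).
have /andP[k1 k2] : k%:R <= x / s2 < k.+1%:R by exact: truncn_itv.
have kx : s2 * k%:R <= x by rewrite mulrC -ler_pdivlMr.
have xk : x < s2 * k%:R + s2.
  by move: k2; rewrite ltr_pdivrMr// -natr1 mulrDl mul1r [_ * s2]mulrC.
have q1 : 0 <= (x - s2 * k%:R) / z by rewrite divr_ge0 ?subr_ge0// ltW.
pose j := Num.truncn ((x - s2 * k%:R) / z).
have /andP[j1 j2] : j%:R <= (x - s2 * k%:R) / z < j.+1%:R by exact: truncn_itv.
have jx : z * j%:R <= x - s2 * k%:R by rewrite mulrC -ler_pdivlMr.
have xj : x - s2 * k%:R < z * j%:R + z.
  by move: j2; rewrite ltr_pdivrMr// -natr1 mulrDl mul1r [_ * z]mulrC.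
have jk0 : (j < k0)%N.
  rewrite ltnS /j; apply: le_truncn; rewrite ler_pM2r ?invr_gt0//; lra.
have k0k : (k0 <= k)%N.
  rewrite /k -(natrK (R := R) k0); apply: le_truncn.
  by rewrite ler_pdivlMr// mulrC.
have kn : (k < n)%N.
  by rewrite ltnS /k; apply: le_truncn; rewrite ler_pM2r ?invr_gt0.
have jk : (j <= k)%N by rewrite (leq_trans (ltnW jk0)).
exists (s2 *+ (k - j) + s1 *+ j).
  apply/allpairsP; exists (k, j).
  by split; [rewrite mem_iota|rewrite mem_iota (leq_ltn_trans jk)|].
have -> : s2 *+ (k - j) + s1 *+ j = s2 * k%:R + z * j%:R.
  by rewrite zE' -[s2 *+ _]mulr_natr -[s1 *+ _]mulr_natr natrB//; lra.
by apply/andP; split; lra.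
Qed.

(** * Approximate renewal equations *)

(** What the convergence proof needs to know about a function [f] and its
    average [F x = E f (x - X)], for a step [X] between [a] and [b] whose support
    contains [A]; [F] is only described by the comparisons that it
    satisfies, so that no integral occurs here. By [rp_avg_mix], a
    neighbourhood of a point of [A] carries a share [p > 0] of the average,
    independent of [x]. The inequalities [rp_lower] and [rp_upper] say that [f]
    is almost [F]: in the second one the point is displaced by
    [4 * exp (- x / 4)], which accounts for the small branches, and the error
    comes from the square of a tail. *)
Record renewal_pair (R : realType) (chi a b : R) (A : set R) (f F : R -> R) :
    Prop := RenewalPair {
  rp_chi : 0 < chi ;
  rp_step : 0 < a ;
  rp_range : a <= b ;
  rp_gt0 : forall x : R, 0 < f x ;
  rp_le_expR : forall x : R, f x <= expR (chi * x) ;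
  rp_slow : forall x y : R, x <= y -> expR (chi * (x - y)) * f y <= f x ;
  rp_avg_le : forall x c : R,
    (forall z : R, a <= z <= b -> f (x - z) <= c) -> F x <= c ;
  rp_avg_ge : forall x c : R,
    (forall z : R, a <= z <= b -> c <= f (x - z)) -> c <= F x ;
  rp_avg_mix : forall s eta : R, A s -> 0 < eta -> exists2 p : R, 0 < p <= 1 &
    forall x c1 c2 : R, (forall z : R, a <= z <= b -> f (x - z) <= c1) ->
      (forall z : R, a <= z <= b -> `|z - s| < eta -> f (x - z) <= c2) ->
      F x <= c1 * (1 - p) + c2 * p ;
  rp_lower : exists2 C : R, 0 <= C & forall x : R, 0 <= x ->
    F x - C * expR (- (chi * x)) * F x ^+ 2 <= f x ;
  rp_upper : forall e K : R, 0 <= e < chi ->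
    (forall x : R, 0 <= x -> f x <= K * expR (e * x)) ->
    exists2 C : R, 0 <= C & exists x0 : R, forall x : R, x0 <= x ->
      f x <= expR (4 * chi * expR (- (x / 4))) * F (x - 4 * expR (- (x / 4)))
             + C * expR ((chi - 3 / 2 * (chi - e)) * x) ;
  rp_init : exists K e : R, 0 <= e < chi /\
    forall x : R, 0 <= x -> f x <= K * expR (e * x) }.

Section renewal.
Variables (R : realType) (chi a b : R) (A : set R) (f F : R -> R).
Hypothesis H : renewal_pair chi a b A f F.

(** One use of [rp_upper] improves the growth rate [e] of [f]: if
    [p = chi - e] then the new rate is [chi - min chi (5 / 4 * p)]. The
    function [K' * (2 - exp (- d x)) * exp (e' x)] is a supersolution: passing
    from [x] to [x - z] with [z >= a] gains a multiple of [exp (- d x)], which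
    for small [d] dominates both the displacement [exp (- x / 4)] and the
    squared error [exp (- p x / 4)], relative to [exp (e' x)]. *)
Lemma growth_step (K e : R) : 0 <= e < chi ->
  (forall x : R, 0 <= x -> f x <= K * expR (e * x)) ->
  exists K', forall x, 0 <= x ->
    f x <= K' * expR ((chi - Num.min chi (5 / 4 * (chi - e))) * x).
Proof.
move=> ee fK; have [C C0 [x0 fC]] := rp_upper H ee fK.
have [chi0 a0] : 0 < chi /\ 0 < a by case: H.
case/andP: ee => e0 echi.
set p := chi - e; have p0 : 0 < p by rewrite subr_gt0.
set e' := chi - _.
have e'0 : 0 <= e' by rewrite subr_ge0 ge_min lexx.
pose d := Num.min (p / 8) (1 / 8).
have d0 : 0 < d by rewrite lt_min; apply/andP; split; lra.
have [dp d8] : d <= p / 8 /\ d <= 1 / 8.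
  by split; rewrite ge_min lexx ?orbT.
pose g := expR (d * a) - 1.
have g0 : 0 < g by rewrite subr_gt0 expR_gt1 mulr_gt0.
have [xa xa0 Ha] := @expRN_small _ (1 / 4) (1 / (8 * chi)) ltac:(lra)
  ltac:(by rewrite divr_gt0// mulr_gt0).
have [xb xb0 Hb] := @expRN_small _ (1 / 4 - d) (g / 2 / (16 * chi)) ltac:(lra)
  ltac:(by rewrite !divr_gt0// mulr_gt0).
have [xc xc0 Hc] := @expRN_small _ (p / 4 - d) (g / 2) ltac:(lra) ltac:(lra).
pose x1 := Num.max (Num.max x0 (b + 4)) (Num.max xa (Num.max xb xc)).
pose K' := Num.max C (expR (chi * x1)).
have [K'C K'x1] : C <= K' /\ expR (chi * x1) <= K'.
  by split; rewrite le_max lexx ?orbT.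
have K'0 : 0 < K' := lt_le_trans (expR_gt0 _) K'x1.
have key (x : R) : 0 <= x -> f x <= K' * (2 - expR (- (d * x))) * expR (e' * x).
  move: x; apply: (@scale_ind _ a 0 x1) => // [x /andP[x_ge0 xx1]|x x1x IH].
    apply: (le_trans (rp_le_expR H x)); apply: (@le_trans _ _ (K' * 1 * 1)).
      by rewrite !mulr1 (le_trans _ K'x1)// ler_expR ler_pM2l.
    apply: ler_pM => //.
    - by rewrite mulr1 ltW.
    - rewrite ler_pM2l// lerBrDr -lerBrDl.
      by rewrite (_ : 2 - 1 = 1) ?expR_le1 ?oppr_le0 ?mulr_ge0 ?(ltW d0)//; lra.
    - by rewrite -expR0 ler_expR mulr_ge0.
  have [[xx0 xb4] [xxa [xxb xxc]]] : (x0 <= x /\ b + 4 <= x) /\ xa <= x /\ xb <= x /\ xc <= x.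
    by move: (ltW x1x); rewrite !ge_max => /andP[/andP[-> ->] /andP[-> /andP[-> ->]]].
  have x_ge0 : 0 <= x by lra.
  set t := expR (- (x / 4)).
  have t0 : 0 < t := expR_gt0 _.
  have t1 : t <= 1 by rewrite expR_le1; lra.
  have tE : t = expR (- (1 / 4 * x)) by congr expR; lra.
  have upt := fC _ xx0; rewrite -/t in upt; clearbody t.
  have Dle : F (x - 4 * t) <= K' * (2 - expR (d * a) * expR (- (d * x))) * expR (e' * x).
    apply: (rp_avg_le H) => z /andP[az zb].
    apply: (le_trans (IH _ _)); first by apply/andP; split; lra.
    apply: ler_pM; last 1 first.
    - by rewrite ler_expR ler_wpM2l//; lra.
    - rewrite mulr_ge0 ?(ltW K'0)// subr_ge0 (@le_trans _ _ 1)//; last lra.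
      rewrite expR_le1 oppr_le0 mulr_ge0//; first exact: ltW.
      by lra.
    - exact: expR_ge0.
    - rewrite ler_pM2l// lerB// -expRD ler_expR.
      have : 0 <= d * (4 * t + z - a) by rewrite mulr_ge0 ?(ltW d0)//; lra.
      by lra.
  apply: (le_trans upt).
  have E1 : expR (4 * chi * t) <= 1 + 2 * (4 * chi * t).
    apply: expR_le_1D2x; rewrite !mulr_ge0 ?(ltW t0) ?(ltW chi0)//=.
    have := Ha _ xxa; rewrite -tE ler_pdivlMr ?mulr_gt0// => h. lra.
  set h := expR (- (d * x)) in Dle *.
  have h0 : 0 < h := expR_gt0 _.
  have h1 : h <= 1 by rewrite expR_le1 oppr_le0 mulr_ge0// ltW.
  have tB : 16 * chi * t <= g / 2 * h.
    have := Hb _ xxb; rewrite ler_pdivlMr ?mulr_gt0// => hb.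
    have -> : t = expR (- ((1 / 4 - d) * x)) * h.
      by rewrite tE -expRD; congr expR; lra.
    rewrite mulrA ler_pM2r// mulrC. lra.
  have cB : C * expR ((chi - 3 / 2 * (chi - e)) * x) <= K' * (g / 2 * h) * expR (e' * x).
    have -> : K' * (g / 2 * h) * expR (e' * x) = K' * ((g / 2 * h) * expR (e' * x)) by lra.
    apply: ler_pM => //; rewrite ?expR_ge0//.
    apply: (@le_trans _ _ (expR (- ((p / 4 - d) * x)) * h * expR (e' * x))).
      rewrite /h -!expRD ler_expR /e'.
      have mle : Num.min chi (5 / 4 * p) <= 5 / 4 * p by rewrite ge_min lexx orbT.
      have : 0 <= (5 / 4 * p - Num.min chi (5 / 4 * p)) * x.
        by rewrite mulr_ge0// subr_ge0.
      by rewrite -/p; lra.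
    by rewrite ler_pM2r ?expR_gt0// ler_pM2r// Hc.
  have q0 := expR_gt0 (e' * x).
  apply: (@le_trans _ _ (expR (4 * chi * t) *
      (K' * (2 - expR (d * a) * h) * expR (e' * x)) +
      K' * (g / 2 * h) * expR (e' * x))).
    by apply: lerD => //; rewrite ler_wpM2l ?expR_ge0.
  rewrite mulrA -mulrDl ler_pM2r//.
  rewrite (_ : expR (4 * chi * t) * _ + _ =
    K' * (expR (4 * chi * t) * (2 - expR (d * a) * h) + g / 2 * h)); last lra.
  rewrite ler_pM2l//.
  have ga : expR (d * a) = 1 + g by rewrite /g; lra.
  rewrite ga. case: (leP 0 (2 - (1 + g) * h)) => hs.
    apply: (@le_trans _ _ ((1 + 2 * (4 * chi * t)) * (2 - (1 + g) * h) + g / 2 * h)).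
      by rewrite lerD2r ler_wpM2r.
    have : 0 <= (8 * chi * t) * ((1 + g) * h).
      by rewrite !mulr_ge0 ?(ltW chi0) ?(ltW t0) ?(ltW h0)//; lra.
    by nra.
  have : 1 <= expR (4 * chi * t) by rewrite -expR0 ler_expR !mulr_ge0 ?(ltW chi0) ?(ltW t0).
  by nra.
exists (K' * 2) => x x_ge0; apply: (le_trans (key _ x_ge0)).
rewrite ler_pM2r ?expR_gt0// ler_pM2l// lerBlDr lerDl expR_ge0//.
Qed.

(** [n] steps turn [p] into [(5 / 4) ^ n * p], capped at [chi]; at [chi] the
    growth rate is zero. *)
Lemma renewal_bounded : exists2 K, 0 < K & forall x, f x <= K.
Proof.
have [K0 [e0 [ee0 fK0]]] := rp_init H.
have chi0 := rp_chi H.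
have it n : exists K, forall x, 0 <= x ->
    f x <= K * expR ((chi - Num.min chi ((5 / 4) ^+ n * (chi - e0))) * x).
  elim: n => [|n [K IH]].
    exists K0 => x x0; rewrite expr0 mul1r.
    case/andP: ee0 => e00 e01.
    rewrite min_r; last lra.
    by rewrite subKr; exact: fK0.
  set m := Num.min _ _ in IH.
  have m0 : 0 < m.
    case/andP: ee0 => e00 e01; rewrite lt_min chi0/=.
    by apply: mulr_gt0; [apply: exprn_gt0; lra|lra].
  have mchi : m <= chi by rewrite ge_min lexx.
  have [] := @growth_step K (chi - m) _ IH; first by apply/andP; split; lra.
  move=> K' HK'; exists K' => x x0; apply: (le_trans (HK' _ x0)).
  rewrite subKr (_ : Num.min chi (5 / 4 * m) = Num.min chi ((5 / 4) ^+ n.+1 * (chi - e0)))//.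
  rewrite exprS -[_ * _ * (chi - e0)]mulrA /m; case: (leP chi ((5 / 4) ^+ n * (chi - e0))) => h.
    by rewrite !min_l//; lra.
  by [].
case/andP: ee0 => e00 e01.
have [n hn] : exists n, chi <= (5 / 4 : R) ^+ n * (chi - e0).
  pose n := (Num.truncn (4 * (chi / (chi - e0)))).+1.
  exists n; rewrite -ler_pdivrMr ?subr_gt0//.
  have B : 1 + n%:R / 4 <= (5 / 4 : R) ^+ n.
    elim: (n) => [|k IH]; first by rewrite expr0 mul0r addr0.
    rewrite exprS -natr1; have : 0 <= k%:R :> R by [].
    by nra.
  apply: le_trans B; have : 4 * (chi / (chi - e0)) < n%:R by rewrite truncnS_gt.
  by lra.
have [K HK] := it n; exists (Num.max 1 K); first by rewrite lt_max ltr01.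
move=> x; case: (leP 0 x) => x0.
  have := HK _ x0; rewrite min_l// subrr mul0r expR0 mulr1 => /le_trans; apply.
  by rewrite le_max lexx orbT.
apply: (le_trans (rp_le_expR H x)); rewrite le_max; apply/orP; left.
by rewrite expR_le1 pmulr_rle0// ltW.
Qed.

Lemma renewal_bounds : exists2 K, 0 < K & forall x, 0 <= F x <= K /\ f x <= K.
Proof.
have [K K0 fK] := renewal_bounded; exists K => // x; split => //; apply/andP; split.
  by apply: (rp_avg_ge H) => z _; exact: ltW (rp_gt0 H _).
by apply: (rp_avg_le H) => z _; exact: fK.
Qed.

Lemma renewal_lower_mul : exists2 C : R, 0 <= C & forall x : R, 0 <= x ->
  F x * (1 - C * expR (- (chi * x))) <= f x.
Proof.
have [K K0 FK] := renewal_bounds; have [C C0 fC] := rp_lower H.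
exists (C * K); first by rewrite mulr_ge0// ltW.
move=> x x0; apply: le_trans (fC x x0).
have [/andP[F0 FleK] _] := FK x; have h0 := expR_gt0 (- (chi * x)).
set h := expR _ in h0 *; clearbody h.
have : 0 <= C * h * (F x * (K - F x)) by rewrite !mulr_ge0 ?subr_ge0// ltW.
by lra.
Qed.

(** Here [k * (1 + D * exp (- chi x))] is a subsolution: one step gains
    [D * (E - 1) * exp (- chi x)], with [E = exp (chi a)], which for
    [D * (E - 1) = 2 * C] is twice the error [C * exp (- chi x)]. *)
Lemma renewal_bounded_below : exists2 k : R, 0 < k & forall x : R, 0 <= x -> k <= f x.
Proof.
have [C C0 fC] := renewal_lower_mul; have [chi0 a0] : 0 < chi /\ 0 < a by case: H.
pose E := expR (chi * a).
have EE : E = expR (chi * a) by [].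
have E1 : 1 < E by rewrite expR_gt1 mulr_gt0.
pose D := 2 * C / (E - 1).
have DE : D * (E - 1) = 2 * C by rewrite mulfVK//; apply/lt0r_neq0; lra.
have D0 : 0 <= D by rewrite divr_ge0//; lra.
have M0 : 0 < 1 + C + D * E.
  have : 0 <= D * E by rewrite mulr_ge0// (le_trans ler01 (ltW E1)).
  by lra.
have [x2 x20 hx2] := @expRN_small _ chi (1 + C + D * E)^-1 chi0 ltac:(by rewrite invr_gt0).
pose x1 := Num.max x2 b.
have [x12 x1b] : x2 <= x1 /\ b <= x1 by rewrite !le_max !lexx orbT.
have x10 : 0 <= x1 := le_trans x20 x12.
pose k0 := expR (chi * (0 - x1)) * f x1.
have k00 : 0 < k0 by rewrite mulr_gt0 ?expR_gt0 ?(rp_gt0 H).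
have k0E : k0 = expR (chi * (0 - x1)) * f x1 by [].
pose k := k0 / (1 + D).
have kD : k * (1 + D) = k0 by rewrite mulfVK//; apply/lt0r_neq0; lra.
have k_gt0 : 0 < k by rewrite divr_gt0//; lra.
clearbody D E k k0.
have key (x : R) : 0 <= x -> k * (1 + D * expR (- (chi * x))) <= f x.
  move: x; apply: (@scale_ind _ a 0 x1) => // [x /andP[x0 xx1]|x x1x IH].
    apply: (@le_trans _ _ k0).
      rewrite -kD ler_pM2l// lerD2l -[leRHS]mulr1 ler_wpM2l// expR_le1.
      by rewrite oppr_le0 mulr_ge0// ltW.
    rewrite k0E; apply: le_trans (rp_slow H xx1); rewrite ler_pM2r ?(rp_gt0 H)//.
    by rewrite ler_expR ler_pM2l// lerB.
  have hh := hx2 x (ltW (le_lt_trans x12 x1x)).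
  have x_ge0 : 0 <= x by lra.
  set h := expR _ in hh *.
  have h0 : 0 < h := expR_gt0 _.
  have Fge : k * (1 + D * (E * h)) <= F x.
    apply: (rp_avg_ge H) => z /andP[az zb].
    apply: (le_trans _ (IH _ _)); last by apply/andP; split; lra.
    rewrite ler_pM2l// lerD2l ler_wpM2l// EE /h -expRD ler_expR.
    have : 0 <= chi * (z - a) by rewrite mulr_ge0 ?subr_ge0// ltW.
    by lra.
  apply: le_trans (fC _ x_ge0); rewrite -/h; clearbody h.
  have hM : h * (1 + C + D * E) <= 1.
    by rewrite -ler_pdivlMr// div1r.
  have Ch : C * h <= 1.
    have : 0 <= h * (D * E) by rewrite !mulr_ge0//; lra.
    by lra.
  have DEh : D * E * h <= 1 by have : 0 <= C * h; [rewrite mulr_ge0// ltW|lra].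
  apply: (@le_trans _ _ (k * (1 + D * (E * h)) * (1 - C * h))); last first.
    by rewrite ler_wpM2r// subr_ge0.
  rewrite -mulrA ler_pM2l//.
  have : 0 <= C * h * (1 - D * E * h) by rewrite !mulr_ge0 ?subr_ge0// ltW.
  have : D * E * h = 2 * C * h + D * h by rewrite -DE; lra.
  by lra.
exists k => // x x0; apply: le_trans (key x x0).
by rewrite -[leLHS]mulr1 ler_pM2l// lerDl mulr_ge0// expR_ge0.
Qed.

(** The steps have length at most [b], so they cannot jump over the window,
    and the errors met on the way sum up to a multiple of the first one:
    with [D * (E - 1) = C * K], the function
    [c - D * exp (- chi (x - b)) + D * exp (- chi y)] is a subsolution that is
    at most [c] on the window. *)
Lemma window_propagates (e : R) : 0 < e -> exists2 x0 : R, 0 <= x0 &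
  forall x c : R, x0 <= x -> (forall y : R, x - b <= y <= x -> c <= f y) ->
  forall y : R, x <= y -> c - e <= f y.
Proof.
move=> e0; have [C C0 fC] := renewal_lower_mul; have [K K0 FK] := renewal_bounds.
have [chi0 a0] : 0 < chi /\ 0 < a by case: H.
pose E := expR (chi * a).
have EE : E = expR (chi * a) by [].
have E1 : 1 < E by rewrite expR_gt1 mulr_gt0.
pose D := C * K / (E - 1).
have DE : D * (E - 1) = C * K by rewrite mulfVK//; apply/lt0r_neq0; lra.
have D0 : 0 <= D by rewrite divr_ge0 ?mulr_ge0 ?(ltW K0)//; lra.
have [x2 x20 hx2] := @expRN_small _ chi (e / (1 + D)) chi0 ltac:(by rewrite divr_gt0//; lra).
exists (Num.max 0 (x2 + b)); first by rewrite le_max lexx.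
move=> x c; rewrite ge_max => /andP[x0 xb] win.
have h2 := hx2 (x - b) ltac:(lra).
set h := expR _ in h2; have h0 : 0 < h := expR_gt0 _.
have key (y : R) : x - b <= y -> c - D * h + D * expR (- (chi * y)) <= f y.
  move: y; apply: (@scale_ind _ a (x - b) x) => // [y xyb|y xy IH].
    apply: (le_trans _ (win _ xyb)); rewrite -addrA gerDl addrC subr_le0.
    rewrite ler_wpM2l// /h ler_expR lerN2 ler_pM2l//.
    by case/andP: xyb.
  have Fge : c - D * h + D * (E * expR (- (chi * y))) <= F y.
    apply: (rp_avg_ge H) => z /andP[az zb].
    apply: (le_trans _ (IH _ _)); last by apply/andP; split; lra.
    rewrite lerD2l ler_wpM2l// /E -expRD ler_expR.
    have : 0 <= chi * (z - a) by rewrite mulr_ge0 ?subr_ge0// ltW.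
    by lra.
  have y_ge0 : 0 <= y by lra.
  apply: le_trans (fC _ y_ge0).
  have [/andP[F0 FleK] _] := FK y.
  have hy := expR_gt0 (- (chi * y)); set hh := expR _ in hy Fge *.
  clearbody hh E D h.
  have : 0 <= C * hh * (K - F y) by rewrite !mulr_ge0 ?subr_ge0// ltW.
  have : D * E * hh = C * K * hh + D * hh by rewrite -DE; lra.
  by lra.
move=> y xy; have := hx2 (x - b) ltac:(lra); rewrite -/h.
rewrite ler_pdivlMr; last lra.
move=> h3; have b0 : 0 <= b by have := rp_range H; lra.
apply: le_trans (key y _); last lra.
have : 0 <= D * expR (- (chi * y)) by rewrite mulr_ge0// expR_ge0.
by clearbody h D; lra.
Qed.

Lemma renewal_limsup : exists2 L : R, 0 < L &
  forall e : R, 0 < e -> (exists U : R, forall x, U <= x -> f x <= L + e) /\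
    forall U : R, exists2 x, U <= x & L - e <= f x.
Proof.
have [K K0 FK] := renewal_bounds; have [k k0 fk] := renewal_bounded_below.
pose B : set R := [set l | exists U : R, forall x, U <= x -> f x <= l].
have Blb : lbound B k.
  move=> l [U HU]; apply: le_trans (HU (Num.max 0 U) _).
    by apply: fk; rewrite le_max lexx.
  by rewrite le_max lexx orbT.
have Bi : has_inf B by split; [exists K, 0 => x _; case: (FK x)|exists k].
exists (inf B); first by apply: lt_le_trans k0 _; apply: lb_le_inf => //; case: Bi.
move=> e e0; split.
  have [l [U HU] lB] := inf_adherent e0 Bi.
  by exists U => x /HU /le_trans; apply; exact: ltW.
move=> U; apply: contrapT => hU.
have : B (inf B - e).
  exists U => x Ux; rewrite leNgt; apply/negP => /ltW h; apply: hU.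
  by exists x.
by move=> /(ge_inf (proj2 Bi)); lra.
Qed.

(** Otherwise [f] would be at most [L - e] around [x - s], on a share [p] of the
    average that nearly equals [f x], and at most [L + d] elsewhere; this
    average is below [L - d] when [d] is small compared to [e * p]. *)
Lemma recurrent_shift_step (L s : R) :
  (forall e : R, 0 < e -> exists U : R, forall x, U <= x -> f x <= L + e) ->
  A s -> recurrent_shift f L s.
Proof.
move=> fL As e e0; have [chi0 a0] : 0 < chi /\ 0 < a by case: H.
have [K K0 FK] := renewal_bounds.
have [p /andP[p0 p1] Fmix] := rp_avg_mix H As (eta := e / 2) ltac:(lra).
have [C C0 [x0 fC]] := rp_upper H (e := 0) (K := K) ltac:(by rewrite lexx)
  ltac:(by move=> x _; rewrite mul0r expR0 mulr1; case: (FK x)).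
pose d := e * p / 8; have d0 : 0 < d by rewrite divr_gt0// mulr_gt0.
have [U0 HU0] := fL _ d0.
have [xa xa0 Ha] := @expRN_small _ (1 / 4) (1 / (8 * chi)) ltac:(lra)
  ltac:(by rewrite divr_gt0// mulr_gt0).
have [xb xb0 Hb] := @expRN_small _ (1 / 4) (e / 8) ltac:(lra) ltac:(lra).
have [xc xc0 Hc] := @expRN_small _ (1 / 4) (d / (8 * chi * K)) ltac:(lra)
  ltac:(by rewrite divr_gt0// !mulr_gt0).
have [xd xd0 Hd] := @expRN_small _ (chi / 2) (d / (1 + C)) ltac:(lra)
  ltac:(by rewrite divr_gt0//; lra).
exists d => //.
exists (Num.max (Num.max x0 (U0 + b + 4)) (Num.max (Num.max xa xb) (Num.max xc xd))).
move=> x; rewrite !ge_max => /andP[/andP[xx0 xU0] /andP[/andP[xxa xxb] /andP[xxc xxd]]] Lx.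
have x_ge0 := le_trans xa0 xxa.
apply: contrapT => noz.
have upx := fC x xx0; set t := expR (- (x / 4)) in upx.
have tE : t = expR (- (1 / 4 * x)) by congr expR; lra.
have t0 : 0 < t := expR_gt0 _.
have t1 : t <= 1 by rewrite expR_le1; lra.
have ta : 4 * chi * t <= 1 / 2.
  by have := Ha _ xxa; rewrite -tE ler_pdivlMr ?mulr_gt0// => h; lra.
have tb : t <= e / 8 by rewrite tE; exact: Hb.
have tc : 8 * chi * t * K <= d.
  have := Hc _ xxc; rewrite -tE ler_pdivlMr ?mulr_gt0// => h; lra.
have E1 : expR (4 * chi * t) <= 1 + 2 * (4 * chi * t).
  by apply: expR_le_1D2x; rewrite ta !mulr_ge0// ltW.
have td : C * expR ((chi - 3 / 2 * (chi - 0)) * x) <= d.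
  have -> : (chi - 3 / 2 * (chi - 0)) * x = - (chi / 2 * x) by lra.
  have := Hd _ xxd; have := expR_gt0 (- (chi / 2 * x)).
  set h := expR _ => h0; rewrite ler_pdivlMr; last lra.
  by clearbody h d; lra.
clearbody t.
have Fle : F (x - 4 * t) <= (L + d) * (1 - p) + (L - e) * p.
  apply: Fmix => z /andP[az zb]; first by apply: HU0; lra.
  move=> zs; rewrite leNgt; apply/negP => /ltW Lz; apply: noz.
  exists (x - 4 * t - z) => //; rewrite ler_norml.
  by move: zs; rewrite ltr_norml => /andP[z1 z2]; apply/andP; split; lra.
have [/andP[F0 FleK] _] := FK (x - 4 * t).
have hF : expR (4 * chi * t) * F (x - 4 * t) <= F (x - 4 * t) + 8 * chi * t * K.
  apply: (@le_trans _ _ ((1 + 2 * (4 * chi * t)) * F (x - 4 * t))).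
    by rewrite ler_wpM2r.
  have : 0 <= 8 * chi * t * (K - F (x - 4 * t)).
    by rewrite !mulr_ge0 ?subr_ge0// ltW.
  by lra.
have dE : e * p = 8 * d by rewrite /d; lra.
have : 0 <= d * p by rewrite mulr_ge0// ltW.
by clearbody d; lra.
Qed.

(** Within a window far behind a point where [f] is almost [L], each [y] has a
    point [z] slightly to its right, [y <= z <= y + 3 * eta], with [f z] almost
    [L]; and [f] cannot be much smaller at [y] than at [z] by [rp_slow]. *)
Lemma renewal_limit : (forall s, A s -> 0 < s) -> dense (int_span A) ->
  exists2 l : R, 0 < l & f x @[x --> +oo] --> l.
Proof.
move=> A_gt0 dA; have [chi0 a0] : 0 < chi /\ 0 < a by case: H.
have b0 : 0 <= b by have := rp_range H; lra.
have [L L0 HL] := renewal_limsup; have [K K0 FK] := renewal_bounds.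
have window (e : R) (U0 : R) : 0 < e -> exists2 x : R, U0 <= x &
    forall y : R, x - b <= y <= x -> L - e <= f y.
  move=> e0; pose eta := e / (1 + 3 * chi * K).
  have M0 : 0 < 1 + 3 * chi * K by have := mulr_gt0 chi0 K0; lra.
  have eta0 : 0 < eta by rewrite divr_gt0.
  have etaE : eta * (1 + 3 * chi * K) = e by rewrite mulfVK// lt0r_neq0.
  have [T [r rS HT]] := @semigroup_dense _ A (recurrent_shift f L) eta b A_gt0 dA
    (@recurrent_shift0 _ f L) (@recurrent_shiftD _ f L)
    (fun s As => recurrent_shift_step (fun e e0 => proj1 (HL e e0)) As) eta0 b0.
  have [d d0 [U HU]] := recurrent_shift_seq eta0 rS.
  clearbody eta.
  have [x' xU Lx] := proj2 (HL d d0) (Num.max U (U0 + eta + T)).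
  move: xU; rewrite ge_max => /andP[xU xU0].
  exists (x' - eta - T); first lra.
  move=> y /andP[y1 y2].
  have [s sr /andP[s1 s2]] := HT (x' - y - eta) ltac:(apply/andP; split; lra).
  have [z] := HU x' s sr xU Lx; rewrite ler_norml => /andP[z1 z2] Lz.
  have yz : y <= z by lra.
  apply: le_trans (rp_slow H yz).
  have zy : - (3 * chi * eta) <= chi * (y - z).
    have : 0 <= chi * (y - z + 3 * eta) by rewrite mulr_ge0 ?(ltW chi0)//; lra.
    by lra.
  have E1 : 1 - 3 * chi * eta <= expR (chi * (y - z)).
    by apply: le_trans (expR_ge1Dx _); lra.
  apply: (@le_trans _ _ ((1 - 3 * chi * eta) * f z)).
    have [_ fzK] := FK z.
    have : 0 <= 3 * chi * eta * (K - f z).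
      by rewrite !mulr_ge0 ?subr_ge0// ltW.
    by lra.
  by rewrite ler_wpM2r// ltW// (rp_gt0 H).
exists L => //; apply/cvgrPdist_le => e e0.
have e2 : 0 < e / 2 by lra.
have [U HU] := proj1 (HL e e0).
have [x0 _ Hprop] := window_propagates e2.
have [x xx0 Hx] := window _ x0 e2.
have := Hprop _ _ xx0 Hx => low.
exists (Num.max U x); split; first by rewrite num_real.
move=> y; rewrite gt_max => /andP[/ltW Uy /ltW xy].
have := HU _ Uy; have := low _ xy => h1 h2.
by rewrite ler_norml; apply/andP; split; lra.
Qed.

End renewal.

(** * Configurations and their law *)

Section configurations.
Variable R : realType.

Definition raw_config : Type := ((vertex -> nat) * (edge -> R))%type.

HB.instance Definition _ := Pointed.on raw_config.

Definition coord_event (i : vertex + edge) : set (set raw_config) :=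
  match i with
  | inl v => [set (fun x : raw_config => x.1 v) @^-1` B
               | B in [set B : set nat | measurable B]]
  | inr e => [set (fun x : raw_config => x.2 e) @^-1` B
               | B in [set B : set R | measurable B]]
  end.

Definition cylinder : set (set raw_config) :=
  [set C | exists (s : seq (vertex + edge)) (E : vertex + edge -> set raw_config),
    (forall i, i \in s -> coord_event i (E i)) /\
    C = \bigcap_(i in [set` s]) E i].

Definition config : measurableType cylinder.-sigma :=
  g_sigma_algebraType cylinder.

Lemma coord_eventT i : coord_event i setT.
Proof. by case: i => i; exists setT => //=. Qed.

Lemma coord_eventI i A B :
  coord_event i A -> coord_event i B -> coord_event i (A `&` B).
Proof.
by case: i => i [A' mA <-] [B' mB <-]; exists (A' `&` B') => //=; exact: measurableI.
Qed.

Lemma coord_event_cylinder i E : coord_event i E -> cylinder E.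
Proof.
move=> iE; exists [:: i], (fun=> E); split; first by move=> j; rewrite inE => /eqP ->.
apply/seteqP; split => [x Ex j|x]; first by [].
by apply; rewrite /= inE.
Qed.

Lemma coord_event_measurable i (E : set config) : coord_event i E -> measurable E.
Proof. by move=> /coord_event_cylinder; exact: sub_sigma_algebra. Qed.

Lemma cylinder_setI : setI_closed cylinder.
Proof.
move=> _ _ [s [E [sE ->]]] [t [F [tF ->]]].
exists (s ++ t), (fun i => (if i \in s then E i else setT) `&`
                           (if i \in t then F i else setT)); split.
  move=> i _; apply: coord_eventI.
    by case: ifP => [/sE //|_]; exact: coord_eventT.
  by case: ifP => [/tF //|_]; exact: coord_eventT.
apply/seteqP; split => x.
  move=> [hs ht] i _; split; case: ifPn => // ir; [exact: hs|exact: ht].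
move=> hx; split => i /= ir.
  by have [] := hx i; rewrite /= ?mem_cat ?ir ?orbT.
by have [_] := hx i ltac:(by rewrite /= mem_cat ir orbT); rewrite ir.
Qed.

Record realizes (h : probability nat R) (nu : probability R R)
    (d : measure_display) (Omega : measurableType d) (P : probability Omega R)
    (X : Omega -> config) : Prop := {
  realizes_event : forall i E, coord_event i E -> measurable (X @^-1` E) ;
  realizes_offspring : forall v (B : set nat), P [set w | B ((X w).1 v)] = h B ;
  realizes_bias : forall e (B : set R), measurable B ->
    P [set w | B ((X w).2 e)] = nu B ;
  realizes_indep : forall (s : seq (vertex + edge)) E, uniq s ->
    (forall i, i \in s -> coord_event i (E i)) ->
    P (X @^-1` (\bigcap_(i in [set` s]) E i)) =
    (\prod_(i <- s) P (X @^-1` (E i)))%E }.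

Section realizes_theory.
Variables (h : probability nat R) (nu : probability R R).

Lemma realizes_measurable d (Omega : measurableType d) (P : probability Omega R)
  (X : Omega -> config) : realizes h nu P X -> measurable_fun setT X.
Proof.
move=> H; apply: (@measurability _ _ Omega config setT X cylinder) => //.
move=> _ [_ [s [E [sE ->]]] <-]; rewrite setTI.
rewrite preimage_bigcap; apply: fin_bigcap_measurable => //.

by move=> i /sE; exact: realizes_event H _ _.
Qed.

Definition config_law d (Omega : measurableType d) (P : probability Omega R)
    (X : Omega -> config) (mX : measurable_fun setT X) : probability config R :=
  let X' : {mfun Omega >-> config} :=
    HB.pack_for {mfun Omega >-> config} X (isMeasurableFun.Build _ _ _ _ _ mX) in
  distribution P X'.

Lemma lawE d (Omega : measurableType d) (P : probability Omega R)
    (X : Omega -> config) (mX : measurable_fun setT X) E :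
  config_law P mX E = P (X @^-1` E).
Proof. by []. Qed.

Lemma realizes_marginal d (Omega : measurableType d) (P : probability Omega R)
    (X : Omega -> config) d' (Omega' : measurableType d')
    (P' : probability Omega' R) (X' : Omega' -> config) i E :
  realizes h nu P X -> realizes h nu P' X' -> coord_event i E ->
  P (X @^-1` E) = P' (X' @^-1` E).
Proof.
move=> H H'; case: i => [v|e] [B mB <-].
  by rewrite (realizes_offspring H v B) -(realizes_offspring H' v B).
by rewrite (realizes_bias H e mB) -(realizes_bias H' e mB).
Qed.

(** The cylinders are stable under intersection, generate the sigma-algebra, and
    their probabilities are products of one-coordinate probabilities. *)
Lemma realizes_unique d (Omega : measurableType d) (P : probability Omega R)
    (X : Omega -> config) d' (Omega' : measurableType d')
    (P' : probability Omega' R) (X' : Omega' -> config) (E : set config) :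
  realizes h nu P X -> realizes h nu P' X' -> measurable E ->
  P (X @^-1` E) = P' (X' @^-1` E).
Proof.
move=> H H' mE.
have mX := realizes_measurable H; have mX' := realizes_measurable H'.
rewrite -(lawE P mX) -(lawE P' mX').
refine (@measure_unique _ R config cylinder (fun=> setT) erefl _ _ _
  (config_law P mX) (config_law P' mX') _ _ _ mE) => //.
- exact: cylinder_setI.
- by move=> _; apply: (@coord_event_cylinder (inl [::])); exact: coord_eventT.
- by rewrite -subTset => x _; exists 0%N.
- move=> _ [s [F [sF ->]]].
  change (P (X @^-1` (\bigcap_(i in [set` s]) F i)) =
          P' (X' @^-1` (\bigcap_(i in [set` s]) F i))).
  have -> : \bigcap_(i in [set` s]) F i = \bigcap_(i in [set` undup s]) F i.
    by congr bigcap; apply/seteqP; split => x /=; rewrite mem_undup.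
  have sF' i : i \in undup s -> coord_event i (F i) by rewrite mem_undup; exact: sF.
  rewrite (realizes_indep H (undup_uniq s) sF') (realizes_indep H' (undup_uniq s) sF').
  by apply: eq_big_seq => i /sF'; exact: realizes_marginal.
- move=> _; change (P (X @^-1` setT) < +oo)%E.
  by rewrite preimage_setT probability_setT ltry.
Qed.

End realizes_theory.
End configurations.

(** * Subtrees and resampling *)

Section reindexing.
Variables (R : realType) (h : probability nat R) (nu : probability R R).

Definition subtree (i : nat) (x : config R) : config R :=
  (fun v => x.1 (i :: v), fun e => x.2 (i :: e.1, e.2)).

Definition subtree_index (i : nat) (j : vertex + edge) : vertex + edge :=
  match j with inl v => inl (i :: v) | inr e => inr (i :: e.1, e.2) end.

Lemma subtree_index_inj i : injective (subtree_index i).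
Proof. by move=> [v|[v n]] [w|[w m]] //= [->] // ->. Qed.

Lemma coord_event_subtree i j (E : set (config R)) :
  coord_event j E -> coord_event (subtree_index i j) (subtree i @^-1` E).
Proof. by case: j => [v|e] [B mB <-]; exists B. Qed.

Lemma realizes_subtree i d (Omega : measurableType d) (P : probability Omega R)
    (X : Omega -> config R) :
  realizes h nu P X -> realizes h nu P (subtree i \o X).
Proof.
move=> H; split.
- move=> j E /(coord_event_subtree i); exact: realizes_event H _ _.
- by move=> v B; rewrite -(realizes_offspring H (i :: v) B).
- by move=> e B mB; rewrite -(realizes_bias H (i :: e.1, e.2) mB).
- move=> s E us sE.
  pose E' (k : vertex + edge) : set (config R) := match k with
    | inl (_ :: v) => subtree i @^-1` E (inl v)
    | inr (_ :: v, n) => subtree i @^-1` E (inr (v, n))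
    | _ => setT end.
  have E'E j : E' (subtree_index i j) = subtree i @^-1` E j by case: j => [v|[v n]].
  have -> : (subtree i \o X) @^-1` (\bigcap_(j in [set` s]) E j) =
      X @^-1` (\bigcap_(k in [set` map (subtree_index i) s]) E' k).
    apply/seteqP; split => w /= hw k /=.
      by move=> /mapP[j js ->]; rewrite E'E; exact: hw.
    by move=> ks; have := hw _ (map_f (subtree_index i) ks); rewrite E'E.
  rewrite (realizes_indep H).
  + by rewrite big_map; apply: eq_bigr => j _; rewrite E'E.
  + by rewrite map_inj_uniq//; exact: subtree_index_inj.
  + by move=> _ /mapP[j js ->]; rewrite E'E; apply: coord_event_subtree; exact: sE.
Qed.

Definition mix (c : pred (vertex + edge)) (xy : config R * config R) : config R :=
  (fun v => if c (inl v) then xy.1.1 v else xy.2.1 v,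
   fun e => if c (inr e) then xy.1.2 e else xy.2.2 e).

Lemma mix_preimage c j (E : set (config R)) : coord_event j E ->
  mix c @^-1` E = if c j then E `*` [set: config R] else [set: config R] `*` E.
Proof.
case: j => [v|e] [B mB <-]; rewrite /mix /preimage/=; case: ifP => _;
  by apply/seteqP; split => -[x y] //= [].
Qed.

(** An intersection of one-coordinate events is the product of the events on the
    selected coordinates and those on the other ones. *)
Lemma realizes_mix c (P : probability (config R) R) :
  realizes h nu P id -> realizes h nu (P \x P)%E (mix c).
Proof.
move=> H.
have mE j (E : set (config R)) : coord_event j E -> measurable E.
  exact: coord_event_measurable.
have PmixE j E : coord_event j E -> (P \x P)%E (mix c @^-1` E) = P E.
  move=> jE; rewrite (mix_preimage c jE); have mE' := mE _ _ jE; case: ifP => _.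
    rewrite [LHS]product_measure1E// -[RHS]mule1; congr (_ * _)%E.
    exact: probability_setT.
  rewrite [LHS]product_measure1E// -[RHS]mul1e; congr (_ * _)%E.
  exact: probability_setT.
split.
- move=> j E jE; rewrite (mix_preimage c jE); have mE' := mE _ _ jE.
  by case: ifP => _; apply: measurableX.
- move=> v B; rewrite -(realizes_offspring H v B).
  by apply: (PmixE (inl v)); exists B.
- move=> e B mB; rewrite -(realizes_bias H e mB).
  by apply: (PmixE (inr e)); exists B.
- move=> s E us sE.
  pose s1 := [seq j <- s | c j]; pose s2 := [seq j <- s | ~~ c j].
  have sE1 j : j \in s1 -> coord_event j (E j).
    by rewrite mem_filter => /andP[_ /sE].
  have sE2 j : j \in s2 -> coord_event j (E j).
    by rewrite mem_filter => /andP[_ /sE].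
  have mcap (t : seq (vertex + edge)) : (forall j, j \in t -> coord_event j (E j)) ->
      measurable (\bigcap_(j in [set` t]) E j : set (config R)).
    move=> tE; apply: fin_bigcap_measurable; first exact: finite_seq.
    by move=> j jt; apply: mE; exact: tE.
  have -> : mix c @^-1` (\bigcap_(j in [set` s]) E j) =
      (\bigcap_(j in [set` s1]) E j) `*` (\bigcap_(j in [set` s2]) E j).
    apply/seteqP; split => [xy hxy|xy [hx hy]].
      split => j /=; rewrite mem_filter => /andP[cj js];
        have : (mix c @^-1` E j) xy by [exact: hxy].
        by rewrite (mix_preimage c (sE _ js)) cj => -[].
      by rewrite (mix_preimage c (sE _ js)) (negPf cj) => -[].
    move=> j /= js; change ((mix c @^-1` E j) xy).
    rewrite (mix_preimage c (sE _ js)); case: ifPn => cj; split => //.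
      by apply: hx; rewrite /= mem_filter cj.
    by apply: hy; rewrite /= mem_filter cj.
  rewrite [LHS]product_measure1E; [|exact: mcap|exact: mcap].
  transitivity ((\prod_(j <- s1) P (E j)) * (\prod_(j <- s2) P (E j)))%E.
    have h1 := realizes_indep H (filter_uniq c us) sE1.
    have h2 := realizes_indep H (filter_uniq (predC c) us) sE2.
    by congr (_ * _)%E; [exact: h1|exact: h2].
  rewrite !big_filter [RHS](bigID c)/=; congr (_ * _)%E.
    rewrite big_seq_cond [RHS]big_seq_cond.
    by apply: eq_bigr => j /andP[/sE jE _]; rewrite (PmixE _ _ jE).
  rewrite big_seq_cond [RHS]big_seq_cond.
  by apply: eq_bigr => j /andP[/sE jE _]; rewrite (PmixE _ _ jE).
Qed.

Lemma weighted_GW_realizes d (Omega : measurableType d) (P : probability Omega R)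
    (N : vertex -> {RV P >-> nat}) (beta : edge -> {RV P >-> R}) :
  weighted_GW h nu N beta ->
  realizes h nu P (fun w => (fun v => N v w, fun e => beta e w) : config R).
Proof.
move=> H; set X := fun w => _.
have Xev i E : coord_event i E -> match i with
    | inl v => sigma_of (N v) | inr e => sigma_of (beta e) end (X @^-1` E).
  by case: i => [v|e] [B mB <-]; exists B.
split.
- move=> i E /Xev; case: i => [v|e] [B mB <-];
    by rewrite -[X in measurable X]setTI; apply: measurable_funPT.
- by move=> v B; rewrite -(weighted_GW_offspring H v (A := B)).
- by move=> e B mB; rewrite -(weighted_GW_bias H e mB).
- move=> s E us sE; rewrite preimage_bigcap.
  by apply: (weighted_GW_indep H) => // i /sE; exact: Xev.
Qed.

End reindexing.

Section invariance.
Variables (R : realType) (h : probability nat R) (nu : probability R R).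
Variable P : probability (config R) R.
Hypothesis HP : realizes h nu P id.

Lemma measurable_subtree i : measurable_fun setT (@subtree R i).
Proof. exact: realizes_measurable (realizes_subtree i HP). Qed.

Lemma law_subtree i (E : set (config R)) : measurable E ->
  P (subtree i @^-1` E) = P E.
Proof. by move=> mE; exact: realizes_unique (realizes_subtree i HP) HP mE. Qed.

Lemma law_mix c (E : set (config R)) : measurable E ->
  P E = (P \x P)%E (mix c @^-1` E).
Proof. by move=> mE; exact: realizes_unique HP (realizes_mix c HP) mE. Qed.

(** Two events that depend on disjoint sets of coordinates become a rectangle
    after resampling. *)
Lemma independent_events c (E F : set (config R)) :
  measurable E -> measurable F ->
  (forall x y, E (mix c (x, y)) <-> E x) -> (forall x y, F (mix c (x, y)) <-> F y) ->
  P (E `&` F) = (P E * P F)%E.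
Proof.
move=> mE mF Ec Fc; rewrite (law_mix c); last exact: measurableI.
rewrite -[RHS]product_measure1E//; congr ((P \x P)%E _).
by apply/seteqP; split => -[x y] /= [/Ec ? /Fc ?].
Qed.

End invariance.

Local Open Scope ereal_scope.

(** * The tree weight as a function of the configuration *)

Lemma esum_gtP (R : realType) (T : choiceType) (S : set T) (a : T -> \bar R)
    (u : \bar R) :
  u < \esum_(v in S) a v <->
  exists r : seq T, [/\ uniq r, forall v, v \in r -> S v & u < \sum_(v <- r) a v].
Proof.
split => [/ereal_sup_gt[_ [X [finX XS] <-]]|[r [ur rS ur']]].
  rewrite fsbig_finite// => uX; exists (finmap.enum_fset (fset_set X)); split => //.
  by move=> v; rewrite in_fset_set// inE; exact: XS.
apply: (lt_le_trans ur'); apply: ereal_sup_ubound; exists [set` r].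
  by split; [exact: finite_seq|move=> v /rS].
by rewrite [in RHS]fsbig_seq.
Qed.

Lemma esumZl (R : realType) (T : choiceType) (S : set T) (a : T -> \bar R) (c : R) :
  (0 <= c)%R -> (forall v, 0 <= a v) ->
  \esum_(v in S) (c%:E * a v) = c%:E * \esum_(v in S) a v.
Proof.
move=> c0 a0; rewrite /esum -ereal_supZl//; last first.
  by apply/set0P; exists (\sum_(x \in set0) a x); exists set0 => //; exact: fsets_set0.
rewrite image_comp; congr ereal_sup; apply: eq_imagel => X _ /=.
by rewrite ge0_mule_fsumr.
Qed.

Local Notation tree_of := Defs.tree_of.

Section tree_recursion.
Variable R : realType.
Implicit Types (n : vertex -> nat) (b : edge -> R).

Definition child_offspring (i : nat) n : vertex -> nat := fun v => n (i :: v).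
Definition child_bias (i : nat) b : edge -> R := fun e => b (i :: e.1, e.2).

Lemma tree_of_cons n i v :
  tree_of n (i :: v) <-> (i < n [::])%N /\ tree_of (child_offspring i n) v.
Proof.
split => [h|[h0 h] [|j] /=]; first by split; [exact: (h 0%N)|move=> j jv; exact: (h j.+1)].
  by [].
by rewrite ltnS; exact: h.
Qed.

Lemma vertex_weight_nil b : vertex_weight b [::] = 1%R.
Proof. by rewrite /vertex_weight big_ord0. Qed.

Lemma vertex_weight_cons b i v :
  vertex_weight b (i :: v) = (b ([::], i) * vertex_weight (child_bias i b) v)%R.
Proof. by rewrite /vertex_weight /= big_ord_recl. Qed.

Lemma vertex_weight_ge0 b v : (forall e, 0 <= b e)%R -> (0 <= vertex_weight b v)%R.
Proof. by move=> b0; apply: prodr_ge0. Qed.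

Lemma tree_weight_rec n b : (forall e, 0 <= b e)%R ->
  tree_weight n b = 1 + \sum_(i < n [::]) (b ([::], nat_of_ord i))%:E *
    tree_weight (child_offspring i n) (child_bias i b).
Proof.
move=> b0.
have w0 (b' : edge -> R) v : (forall e, 0 <= b' e)%R -> 0 <= (vertex_weight b' v)%:E.
  by move=> b'0; rewrite lee_fin vertex_weight_ge0.
rewrite /tree_weight (esumID [set [::]]); last by move=> v _; exact: w0.
congr (_ + _).
  rewrite (_ : _ `&` _ = [set [::]]); last by apply/seteqP; split => [v []|v ->].
  by rewrite esum_set1 ?vertex_weight_nil// lee_fin.
pose J i := cons i @` tree_of (child_offspring i n).
have -> : tree_of n `&` ~` [set [::]] = \bigcup_(i in `I_(n [::])) J i.
  apply/seteqP; split => [[|i v] [nv]//= _|v [i ilt [w wt <-]]].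
    by have [ilt vt] := (tree_of_cons n i v).1 nv; exists i => //; exists v.
  by split => //; apply/tree_of_cons.
rewrite esum_bigcupT; last first.
- by move=> v; exact: w0.
- by move=> i j _ _ [_ [[v _ <-] [w _ [->]]]].
rewrite -[`I_ _]set_mem_set esum_fset; last first.
- by move=> i _; apply: esum_ge0 => v _; exact: w0.
- by rewrite set_mem_set; exact: finite_II.
rewrite set_mem_set -fsbig_ord.
apply: eq_bigr => i _; rewrite esum_image; last by move=> v w _ _ [].
rewrite -esumZl//; last by move=> v; apply: w0 => e; exact: b0.
by apply: eq_esum => v _; rewrite vertex_weight_cons EFinM.
Qed.

End tree_recursion.

Section weight.
Variable R : realType.
Implicit Types x : config R.

(** The biases are positive almost surely; taking absolute values makes the
    recursion of the tree weight hold for every configuration. *)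
Definition weight x : \bar R := tree_weight x.1 (fun e => `|x.2 e|%R).

(** The contribution to the weight of the root of its [i]-th child, when
    subtrees are weighed by [V]. Taking for [V] the weight of a truncated tree
    gives the recursion for trees of bounded height. *)
Definition branch (V : config R -> \bar R) (i : nat) x : \bar R :=
  (`|x.2 ([::], i)|%R)%:E * V (subtree i x).

Definition root_degree x : nat := x.1 [::].

Definition truncate (n : nat) x : config R :=
  (fun v => if (size v < n)%N then x.1 v else 0%N, x.2).

Definition weight_upto (n : nat) x : \bar R := weight (truncate n x).

Lemma weight_ge0 x : 0 <= weight x.
Proof. by apply: esum_ge0 => v _; rewrite lee_fin vertex_weight_ge0. Qed.

Lemma weight_rec x :
  weight x = 1 + \sum_(i < root_degree x) branch weight i x.
Proof. exact: tree_weight_rec. Qed.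

Lemma weight_upto0 x : weight_upto 0 x = 1.
Proof. by rewrite /weight_upto weight_rec [X in _ + X]big_ord0 adde0. Qed.

Lemma weight_uptoS n x : weight_upto n.+1 x =
  1 + \sum_(i < root_degree x) branch (weight_upto n) i x.
Proof. exact: weight_rec. Qed.

Lemma weight_gt_upto (u : \bar R) x :
  u < weight x <-> exists n, u < weight_upto n x.
Proof.
split => [/esum_gtP[r [ur rT hu]]|[n hu]].
  exists (\max_(v <- r) size v).+1; apply/esum_gtP; exists r; split => //.
  move=> v vr j jv /=; have sv : (size v <= \max_(w <- r) size w)%N.
    by rewrite (big_rem v vr) /= leq_maxl.
  rewrite size_take jv ltnS (leq_trans (ltnW jv) sv).
  exact: rT.
have /esum_gtP[r [ur rT hu']] := hu; apply/esum_gtP; exists r; split => //.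
by move=> v vr j jv; have := rT v vr j jv; rewrite /=; case: ifP.
Qed.

Lemma weight_upto_nd n m x : (n <= m)%N -> weight_upto n x <= weight_upto m x.
Proof.
move=> nm; rewrite leNgt; apply/negP => /esum_gtP[r [ur rT hu]].
suff : weight_upto m x < weight_upto m x by rewrite ltxx.
apply/esum_gtP; exists r; split => // v vr j jv; have := rT v vr j jv => /=.
by case: ifP => // h _; rewrite (leq_trans h nm) //; have := rT v vr j jv; rewrite /= h.
Qed.

Lemma measurable_offspring (v : vertex) (B : set nat) :
  measurable [set x : config R | B (x.1 v)].
Proof. by apply: (@coord_event_measurable _ (inl v)); exists B. Qed.

Lemma measurable_bias (e : edge) : measurable_fun setT (fun x : config R => x.2 e).
Proof.
move=> _ B mB; rewrite setTI.
by apply: (@coord_event_measurable _ (inr e)); exists B.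
Qed.

(** The sum over the tree exceeds [u] if and only if one of its countably many
    finite partial sums does. *)
Lemma measurable_tree_weight (phi : R -> R) : measurable_fun setT phi ->
  measurable_fun setT (fun x : config R => tree_weight x.1 (fun e => phi (x.2 e))).
Proof.
move=> mphi; apply: (measurability _ (ErealGenOInfty.measurableE R)) => //.
move=> _ [_ [u ->] <-]; rewrite setTI.
pose mass r (x : config R) := (\sum_(v <- r) vertex_weight (fun e => phi (x.2 e)) v)%R.
pose E (r : seq vertex) : set (config R) := if uniq r then
  (\bigcap_(v in [set` r]) \bigcap_(j in `I_(size v))
     [set x : config R | (nth 0%N v j < x.1 (take j v))%N]) `&`
  (mass r @^-1` `]u, +oo[%classic) else set0.
rewrite (_ : _ @^-1` _ = \bigcup_r E r); last first.
  apply/seteqP; split => [x /=|x [r _]].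
    rewrite in_itv/= andbT => /esum_gtP[r [ur rT hu]].
    exists r => //; rewrite /E ur; split; first by move=> v vr j jv; exact: rT.
    by rewrite /= in_itv/= andbT; move: hu; rewrite sumEFin lte_fin.
  rewrite /E; case: (boolP (uniq r)) => [ur [rT +]|_ []]; rewrite /= !in_itv/= !andbT => hu.
  apply/esum_gtP; exists r; split => //.
  by rewrite sumEFin lte_fin.
apply: countable_bigcupT_measurable; first exact: countableP.
move=> r; rewrite /E; case: (uniq r); last exact: measurable0.
apply: measurableI.
  apply: fin_bigcap_measurable; first exact: finite_seq.
  move=> v _; apply: fin_bigcap_measurable; first exact: finite_II.
  by move=> j _; exact: (measurable_offspring (take j v) [set k | (nth 0%N v j < k)%N]).
have mw : measurable_fun setT (mass r).
  apply: measurable_sum => v; apply: measurable_prod => j _.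
  by apply: (measurableT_comp mphi); exact: measurable_bias.
by rewrite -[X in measurable X]setTI; apply: mw.
Qed.

Lemma measurable_weight : measurable_fun setT weight.
Proof. by apply: measurable_tree_weight; exact: normr_measurable. Qed.

Lemma measurable_truncate n : measurable_fun setT (truncate n).
Proof.
apply: (@measurability _ _ (config R) (config R) setT (truncate n) (@cylinder R)) => //.
move=> _ [_ [s [E [sE ->]]] <-]; rewrite setTI preimage_bigcap.
apply: fin_bigcap_measurable; first exact: finite_seq.
move=> i /sE; case: i => [v|e] [B mB <-].
  rewrite /preimage /truncate/=; case: (size v < n)%N.
    exact: measurable_offspring.
  have [h|h] := pselect (B 0%N).
    by rewrite (_ : [set _ | _] = setT)//; apply/seteqP; split.
  by rewrite (_ : [set _ | _] = set0)//; apply/seteqP; split.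
by apply: (@coord_event_measurable _ (inr e)); exists B.
Qed.

Lemma measurable_weight_upto n : measurable_fun setT (weight_upto n).
Proof. exact: measurableT_comp measurable_weight (measurable_truncate n). Qed.

Lemma weight_ge1 x : 1 <= weight x.
Proof.
rewrite weight_rec leeDl// sume_ge0// => i _.
by rewrite mule_ge0// ?lee_fin// weight_ge0.
Qed.

End weight.

(** * Branches at the root *)

Section branches.
Variables (R : realType) (h : probability nat R) (nu : probability R R).
Variable P : probability (config R) R.
Hypothesis HP : realizes h nu P id.
Variable V : config R -> \bar R.
Hypothesis mV : measurable_fun setT V.

(** The coordinates on which the [i]-th branch depends: those of the subtree of
    the [i]-th child, and the edge that leads to it. *)
Definition in_branch (i : nat) (a : vertex + edge) : bool :=
  match a with
  | inl (j :: _) | inr (j :: _, _) | inr ([::], j) => j == i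
  | inl [::] => false
  end.

Lemma branch_mix_same i x y : branch V i (mix (in_branch i) (x, y)) = branch V i x.
Proof.
rewrite /branch /mix /= eqxx; congr (_ * V _); rewrite /subtree /=.
by congr pair; apply/funext => ? /=; rewrite eqxx.
Qed.

Lemma branch_mix_other i j x y : j != i ->
  branch V j (mix (in_branch i) (x, y)) = branch V j y.
Proof.
move=> ji; rewrite /branch /mix /= (negPf ji); congr (_ * V _); rewrite /subtree /=.
by congr pair; apply/funext => ? /=; rewrite (negPf ji).
Qed.

Lemma measurable_branch i : measurable_fun setT (branch V i).
Proof.
apply: emeasurable_funM.
  apply/measurable_EFinP; apply: (measurableT_comp (@normr_measurable R setT)).
  exact: measurable_bias.
exact: measurableT_comp mV (measurable_subtree HP i).
Qed.

Lemma measurable_egt d (T : measurableType d) (f : T -> \bar R) (t : \bar R) :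
  measurable_fun setT f -> measurable [set x | t < f x].
Proof.
move=> mf; rewrite -[X in measurable X]setTI.
exact: emeasurable_fun_o_infty.
Qed.

(** The tail of [b * V] for an independent bias [b] of law [nu]. *)
Definition ebranch_tail (t : R) : \bar R :=
  \int[nu]_b P [set x | t%:E < (`|b|%R)%:E * V x].

Let mscaled (t : R) :
  measurable [set bx : R * config R | t%:E < (`|bx.1|%R)%:E * V bx.2].
Proof.
apply: measurable_egt; apply: emeasurable_funM.
  apply/measurable_EFinP; apply: (measurableT_comp (@normr_measurable R setT)).
  exact: measurable_fst.
exact: measurableT_comp mV measurable_snd.
Qed.

Lemma measurable_branch_section (t : R) :
  measurable_fun setT (fun b : R => P [set x | t%:E < (`|b|%R)%:E * V x]).
Proof.
have := measurable_fun_xsection P (mscaled t).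
apply: eq_measurable_fun => b _ /=; congr (P _).
by apply/seteqP; split => x; rewrite /xsection /= inE.
Qed.

(** Resampling the bias of the edge makes it independent of the subtree, and the
    subtree has the law of the whole configuration. *)
Lemma ebranch_tailE i (t : R) : P [set x | t%:E < branch V i x] = ebranch_tail t.
Proof.
set A := [set x | _].
have mA : measurable A by apply: measurable_egt; exact: measurable_branch.
rewrite (law_mix HP (pred1 (inr ([::], i))) mA) /product_measure1.
pose phi (b : R) := P [set x | t%:E < (`|b|%R)%:E * V x].
transitivity (\int[P]_x phi (x.2 ([::], i))).
  apply: eq_integral => x _ /=.
  rewrite /phi -(law_subtree HP i (E := [set y | t%:E < _ * V y])); last first.
    by apply: measurable_egt; apply: measurable_funeM.
  congr (P _); apply/seteqP; split => y; rewrite /xsection /preimage /A /branch /mix /=;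
    rewrite inE /= eqxx.
  - by [].
  - by [].
have mb := @measurable_bias R ([::], i).
rewrite (_ : (fun x : config R => phi (x.2 ([::], i))) = phi \o (fun x : config R => x.2 ([::], i)))//.
have phi_ge0 : {in setT, forall b : R, 0 <= phi b} by move=> b _; exact: measure_ge0.
have mphi : measurable_fun setT phi := measurable_branch_section t.
have <- := ge0_integral_pushforward mb P measurableT mphi phi_ge0.
apply: eq_measure_integral => B mB _.
exact: realizes_bias HP ([::], i) B mB.
Qed.

Lemma ebranch_tail_ge0 t : 0 <= ebranch_tail t.
Proof. by apply: integral_ge0. Qed.

Lemma ebranch_tail_le1 t : ebranch_tail t <= 1.
Proof.
rewrite -(ebranch_tailE 0%N); apply: probability_le1.
by apply: measurable_egt; exact: measurable_branch.
Qed.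

Lemma ebranch_tail_fin t : ebranch_tail t \is a fin_num.
Proof.
by rewrite ge0_fin_numE ?ebranch_tail_ge0// (le_lt_trans (ebranch_tail_le1 t)) ?ltry.
Qed.

Definition branch_tail (t : R) : R := fine (ebranch_tail t).

Lemma branch_tailE t : ebranch_tail t = (branch_tail t)%:E.
Proof. by rewrite fineK// ebranch_tail_fin. Qed.

Lemma branch_tail_ge0 t : (0 <= branch_tail t)%R.
Proof. by rewrite fine_ge0// ebranch_tail_ge0. Qed.

Lemma measurable_root_degree k : measurable [set x : config R | root_degree x = k].
Proof. exact: (measurable_offspring [::] [set k]). Qed.

Lemma root_degreeE k : P [set x | root_degree x = k] = h [set k].
Proof. exact: (realizes_offspring HP [::] [set k]). Qed.

Lemma root_branch_prob k i t :
  P ([set x | t%:E < branch V i x] `&` [set x | root_degree x = k]) =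
  ebranch_tail t * h [set k].
Proof.
have mY := measurable_egt t%:E (measurable_branch i).
rewrite (independent_events HP (c := in_branch i))//.
- by rewrite ebranch_tailE root_degreeE.
- exact: measurable_root_degree.
- by move=> x y; rewrite /= branch_mix_same.
Qed.

Lemma root_two_branches_prob k i j t : j != i ->
  P ([set x | t%:E < branch V i x] `&`
     ([set x | t%:E < branch V j x] `&` [set x | root_degree x = k])) =
  ebranch_tail t * ebranch_tail t * h [set k].
Proof.
move=> ji; have mY i' := measurable_egt t%:E (measurable_branch i').
rewrite (independent_events HP (c := in_branch i))//.
- by rewrite ebranch_tailE root_branch_prob muleA.
- by apply: measurableI => //; exact: measurable_root_degree.
- by move=> x y; rewrite /= branch_mix_same.
- by move=> x y; rewrite /= branch_mix_other.
Qed.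

Lemma root_decomposition (A : set (config R)) : measurable A ->
  P A = \sum_(k <oo) P (A `&` [set x | root_degree x = k]).
Proof.
move=> mA; rewrite {1}(_ : A = \bigcup_k (A `&` [set x | root_degree x = k])).
  rewrite measure_semi_bigcup//.
  - by move=> k; apply: measurableI => //; exact: measurable_root_degree.
  - by move=> k l _ _ [x [[_ /= <-] [_ /= <-]]].
  - apply: bigcupT_measurable => k.
    by apply: measurableI => //; exact: measurable_root_degree.
apply/seteqP; split => [x Ax|x [k _ []//]].
by exists (root_degree x).
Qed.

End branches.

(** * Moments of the offspring law *)

Section offspring.
Variables (R : realType) (h : probability nat R).

Definition offspring_prob (k : nat) : R := fine (h [set k]).

Lemma offspring_prob_ge0 k : (0 <= offspring_prob k)%R.
Proof. by rewrite fine_ge0. Qed.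

Lemma offspring_probE k : h [set k] = (offspring_prob k)%:E.
Proof. by rewrite fineK//; exact: fin_num_measure. Qed.

Definition moment (n : nat) : R := fine (\sum_(k <oo) (k%:R ^+ n * offspring_prob k)%:E).

Hypothesis htail : exists2 c : R, (0 < c)%R &
  forall k : nat, \sum_(k <= l <oo) h [set l] <= (expR (- (c * k%:R)))%:E.

Lemma offspring_prob_tail : exists2 c : R, (0 < c)%R &
  forall k, (offspring_prob k <= expR (- (c * k%:R)))%R.
Proof.
have [c c0 hc] := htail; exists c => // k.
rewrite -lee_fin -offspring_probE; apply: le_trans (hc k).
have := @nneseries_lim_ge _ (fun l => h [set l]) xpredT k k.+1 (fun l _ _ => measure_ge0 _ _).
by rewrite big_nat1.
Qed.

Lemma pow_le_exp (c : R) (n k : nat) : (0 < c)%R ->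
  (k%:R ^+ n <= n`!%:R / c ^+ n * expR (c * k%:R))%R.
Proof.
move=> c0; have cn0 : (0 < c ^+ n)%R by rewrite exprn_gt0.
have x0 : (0 <= c * k%:R)%R by rewrite mulr_ge0// ltW.
have e : ((c * k%:R) ^+ n / n`!%:R <= expR (c * k%:R))%R.
  case: n cn0 => [|n] _; first by rewrite expr0 fact0 divr1 (le_trans _ (expR_ge1Dx _))// lerDl.
  by apply: le_trans (expR_ge1Dxn n x0); rewrite lerDr.
have n0 : (0 < n`!%:R :> R)%R by rewrite ltr0n fact_gt0.
apply: (@le_trans _ _ (n`!%:R / c ^+ n * ((c * k%:R) ^+ n / n`!%:R))%R).
  rewrite exprMn le_eqVlt; apply/orP; left; apply/eqP; field.
  by rewrite !lt0r_neq0.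
by rewrite ler_wpM2l// divr_ge0// ltW.
Qed.

Lemma geometric_le (r : R) N : (0 <= r < 1)%R ->
  (\sum_(0 <= k < N) r ^+ k <= (1 - r)^-1)%R.
Proof.
move=> /andP[r0 r1]; have r1' : (0 < 1 - r)%R by rewrite subr_gt0.
suff -> : (\sum_(0 <= k < N) r ^+ k = (1 - r ^+ N) / (1 - r))%R.
  by rewrite ler_pdivrMr// mulVf ?gt_eqF// gerBl exprn_ge0.
elim: N => [|N IH]; first by rewrite big_geq// expr0 subrr mul0r.
rewrite big_nat_recr//= IH exprS -[X in (_ + X)%R](mulfK (lt0r_neq0 r1')) -mulrDl.
by congr (_ / _)%R; ring.
Qed.

Lemma moment_series n :
  \sum_(k <oo) (k%:R ^+ n * offspring_prob k)%:E = (moment n)%:E.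
Proof.
have [c c0 hc] := offspring_prob_tail.
have term_ge0 k : (0 <= k%:R ^+ n * offspring_prob k)%R.
  by rewrite mulr_ge0 ?exprn_ge0// offspring_prob_ge0.
rewrite /moment fineK// ge0_fin_numE; last by apply: nneseries_ge0 => k _ _; rewrite lee_fin.
pose r := expR (- (c / 2)).
have r01 : (0 <= r < 1)%R by rewrite expR_ge0 expR_lt1; lra.
pose C := (n`!%:R / (c / 2) ^+ n)%R.
apply: (@le_lt_trans _ _ (C * (1 - r)^-1)%:E); last exact: ltry.
apply: lime_le; first by apply: is_cvg_nneseries => k _ _; rewrite lee_fin.
apply: nearW => N; rewrite sumEFin lee_fin.
have C0 : (0 <= C)%R by rewrite divr_ge0// exprn_ge0//; lra.
apply: (@le_trans _ _ (\sum_(0 <= k < N) C * r ^+ k)%R).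
  apply: ler_sum => k _.
  have -> : (r ^+ k = expR (c / 2 * k%:R) * expR (- (c * k%:R)))%R.
    by rewrite -expRM_natr -expRD; congr expR; lra.
  rewrite mulrA; apply: ler_pM; rewrite ?exprn_ge0 ?offspring_prob_ge0//.
  by apply: pow_le_exp; lra.
by rewrite -mulr_sumr ler_wpM2l// geometric_le.
Qed.

Lemma moment_ge0 n : (0 <= moment n)%R.
Proof.
rewrite fine_ge0// nneseries_ge0// => k _ _.
by rewrite lee_fin mulr_ge0 ?exprn_ge0// offspring_prob_ge0.
Qed.

Lemma moment_seriesM n (a : R) : (0 <= a)%R ->
  \sum_(k <oo) (k%:R ^+ n * a * offspring_prob k)%:E = (moment n * a)%:E.
Proof.
move=> a0; rewrite mulrC EFinM -moment_series -nneseriesZl; last first.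
  by move=> k _; rewrite lee_fin mulr_ge0 ?exprn_ge0// offspring_prob_ge0.
by apply: eq_eseriesr => k _; rewrite -EFinM; congr EFin; ring.
Qed.

Lemma offspring_meanE : offspring_mean h = (moment 1)%:E.
Proof.
rewrite -moment_series [RHS](nneseries_recl (P := xpredT)) //; last first.
  by move=> k _; rewrite lee_fin mulr_ge0 ?exprn_ge0// offspring_prob_ge0.
rewrite expr1 mul0r add0e /offspring_mean.
by apply: eq_eseriesr => k _; rewrite expr1 offspring_probE.
Qed.

End offspring.

(** * Tail inequalities from the decomposition at the root *)

Lemma union_bound (R : realType) d (T : measurableType d) (P : probability T R)
    (A : nat -> set T) (k : nat) (c : R) :
  (forall i, measurable (A i)) -> (forall i, P (A i) <= c%:E) ->
  P (\bigcup_(i < k) A i) <= (k%:R * c)%:E.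
Proof.
move=> mA Ac; rewrite bigcup_mkord.
apply: (le_trans (@Boole_inequality _ _ _ P A k (fun i _ => mA i))).
apply: (@le_trans _ _ (\sum_(i < k) c%:E)).
  by apply: lee_sum => i _; exact: Ac.
by rewrite sumEFin sumr_const card_ord mulr_natl.
Qed.

Lemma eq_lee (R : realType) (x y : \bar R) : x = y -> x <= y.
Proof. by move=> ->. Qed.

(** Bonferroni's lower bound for the probability of a union, in the symmetric
    case. *)
Lemma bonferroni (R : realType) d (T : measurableType d) (P : probability T R)
    (A : nat -> set T) (a b : R) (k : nat) :
  (forall i, measurable (A i)) -> (forall i, P (A i) = a%:E) ->
  (forall i j, i != j -> P (A i `&` A j) <= b%:E) -> (0 <= b)%R ->
  (k%:R * a)%:E <= P (\bigcup_(i < k) A i) + (k%:R ^+ 2 * b)%:E.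
Proof.
move=> mA Aa Ab b0.
have mU n : measurable (\bigcup_(i < n) A i) by exact: bigcup_measurable.
have finP B : measurable B -> (fine (P B))%:E = P B.
  by move=> mB; rewrite fineK//; exact: fin_num_measure.
elim: k => [|k IH].
  by rewrite !mul0r expr0n mul0r adde0; exact: measure_ge0.
have -> : P (\bigcup_(i < k.+1) A i) =
    P (A k `\` \bigcup_(i < k) A i) + P (\bigcup_(i < k) A i).
  transitivity (P ((A k `\` \bigcup_(i < k) A i) `|` \bigcup_(i < k) A i)).
    congr (P _); rewrite !bigcup_mkord big_ord_recr/=; set U := \big[_/_]_(_ < _) _.
    apply/seteqP; split => x [hx|hx]; [by right| |by right; case: hx|by left].
    by have [Ux|nUx] := pselect (U x); [right|left].
  by apply: measureU => //; [exact: measurableD|rewrite setIC setDIK].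
have e1 : a%:E = P (A k `\` \bigcup_(i < k) A i) + P (A k `&` \bigcup_(i < k) A i).
  by rewrite -(Aa k); exact: measureDI.
have e2 : P (A k `&` \bigcup_(i < k) A i) <= (k%:R * b)%:E.
  rewrite setI_bigcupr (_ : \bigcup_(i < k) _ =
    \bigcup_(i < k) (if i == k then set0 else A k `&` A i)); last first.
    by apply: eq_bigcupr => i /= ik; rewrite ltn_eqF.
  apply: union_bound => i; case: eqVneq => ik //.
  - exact: measurableI.
  - by rewrite measure0 lee_fin.
  - by apply: Ab; rewrite eq_sym.
move: IH e1 e2.
rewrite -(finP _ (mU k)) -(finP _ (measurableD (mA k) (mU k))).
rewrite -(finP _ (measurableI _ _ (mA k) (mU k))).
rewrite -!EFinD !lee_fin => IH [e1] e2; rewrite -natr1 sqrrD expr1n mulr1.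
have : (0 <= k%:R * b)%R by rewrite mulr_ge0.
by lra.
Qed.

Section tail_inequalities.
Variables (R : realType) (h : probability nat R) (nu : probability R R).
Variable P : probability (config R) R.
Hypothesis HP : realizes h nu P id.
Variables V W : config R -> \bar R.
Hypothesis mV : measurable_fun setT V.
Hypothesis mW : measurable_fun setT W.
Hypothesis V0 : forall x, 0 <= V x.
Hypothesis W_rec : forall x, W x = 1 + \sum_(i < root_degree x) branch V i x.

Local Notation g := (branch_tail nu P V).
Local Notation Y i t := [set x : config R | t%:E < branch V i x].
Local Notation D k := [set x : config R | root_degree x = k].
Let mY i t : measurable (Y i t).
Proof. by apply: measurable_egt; exact: measurable_branch HP _ mV _. Qed.
Let mD k : measurable (D k). Proof. exact: measurable_root_degree. Qed.
Let mWu u : measurable [set x | (u : R)%:E < W x]. Proof. exact: measurable_egt. Qed.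

Lemma branch_ge0 i x : 0 <= branch V i x.
Proof. by rewrite mule_ge0// lee_fin. Qed.

Lemma W_ge_branch i x : (i < root_degree x)%N -> branch V i x <= W x.
Proof.
move=> ik; rewrite W_rec (bigD1 (Ordinal ik))//= addeCA leeDl//.
by rewrite adde_ge0// sume_ge0// => j _; exact: branch_ge0.
Qed.

Let PY i k t : P (Y i t `&` D k) = (g t * offspring_prob h k)%:E.
Proof.
by rewrite [LHS](root_branch_prob HP mV) EFinM -(branch_tailE HP mV) -offspring_probE.
Qed.

Let PYY i j k t : j != i ->
  P (Y i t `&` (Y j t `&` D k)) = (g t ^+ 2 * offspring_prob h k)%:E.
Proof.
move=> ji; rewrite [LHS](root_two_branches_prob HP mV _ _ ji) expr2 !EFinM.
by rewrite -(branch_tailE HP mV) -offspring_probE.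
Qed.

Lemma tail_ge_k (u : R) k :
  (k%:R * (g u * offspring_prob h k))%:E <=
  P ([set x | u%:E < W x] `&` D k) +
  (k%:R ^+ 2 * (g u ^+ 2 * offspring_prob h k))%:E.
Proof.
apply: (le_trans (@bonferroni _ _ _ P (fun i => Y i u `&` D k)
  (g u * offspring_prob h k) (g u ^+ 2 * offspring_prob h k) k _ _ _ _)).
- by move=> i; apply: measurableI.
- by move=> i; exact: PY.
- move=> i j ij; rewrite setIACA setIid -setIA; apply: eq_lee.
  by apply: PYY; rewrite eq_sym.
- by rewrite mulr_ge0 ?sqr_ge0 ?offspring_prob_ge0.
rewrite leeD2r// le_measure// ?inE.
- by apply: bigcup_measurable => i _; apply: measurableI.
- by apply: measurableI.
move=> x [i /= ik [Yi Dk]]; split => //; apply: lt_le_trans Yi _.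
by apply: W_ge_branch; rewrite Dk.
Qed.

(** If no two branches exceed [s], all of them but the largest contribute at
    most [k * s] to the sum. *)
Lemma one_or_two_branches (u v s : R) x :
  (0 <= v)%R -> (0 <= s)%R -> (v + (root_degree x)%:R * s + 1 <= u)%R ->
  u%:E < W x ->
  (exists2 i, (i < root_degree x)%N & v%:E < branch V i x) \/
  exists i j, [/\ (i < root_degree x)%N, (j < root_degree x)%N, j != i,
    s%:E < branch V i x & s%:E < branch V j x].
Proof.
move=> v0 s0 uvs uW; rewrite W_rec in uW.
set k := root_degree x in uvs uW *.
have [[i ik vi]|nov] := pselect (exists2 i, (i < k)%N & v%:E < branch V i x).
  by left; exists i.
right; apply: contrapT => notwo; move: uW; apply/negP; rewrite -leNgt.
have Yv (i : 'I_k) : branch V i x <= v%:E.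
  by rewrite leNgt; apply/negP => vi; apply: nov; exists i.
have total : \sum_(i < k) branch V i x <= (v + k%:R * s)%:E.
  have [[i si]|nos] := pselect (exists i : 'I_k, s%:E < branch V i x).
    rewrite (bigD1 i)//= EFinD leeD//.
    apply: (@le_trans _ _ (\sum_(j < k | j != i) s%:E)).
      apply: lee_sum => j ji; rewrite leNgt; apply/negP => sj.
      by apply: notwo; exists i, j; split.
    rewrite sumEFin lee_fin sumr_const -[X in (X <= _)%R]mulr_natl ler_wpM2r// ler_nat.
    by rewrite (leq_trans (max_card _))// card_ord.
  apply: (@le_trans _ _ (\sum_(j < k) s%:E)).
    by apply: lee_sum => j _; rewrite leNgt; apply/negP => sj; apply: nos; exists j.
  by rewrite sumEFin lee_fin sumr_const card_ord -[X in (X <= _)%R]mulr_natl lerDr.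
apply: (@le_trans _ _ (1 + (v + k%:R * s)%:E)); first by rewrite leeD2l.
by rewrite -EFinD lee_fin addrC.
Qed.

(** The pairs of distinct branches number at most [k ^ 2], and each costs the
    square of a tail. *)
Lemma tail_le_k (u v s : R) k :
  (0 <= v)%R -> (0 <= s)%R -> (v + k%:R * s + 1 <= u)%R ->
  P ([set x | u%:E < W x] `&` D k) <=
  ((k%:R * g v + k%:R ^+ 2 * g s ^+ 2) * offspring_prob h k)%:E.
Proof.
move=> v0 s0 uvs.
pose C i j := if j != i then Y i s `&` (Y j s `&` D k) else set0.
have mC i j : measurable (C i j).
  by rewrite /C; case: ifP => // _; apply: measurableI => //; apply: measurableI.
pose A1 := \bigcup_(i < k) (Y i v `&` D k).
pose A2 := \bigcup_(i < k) \bigcup_(j < k) C i j.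
have mA1 : measurable A1 by apply: bigcup_measurable => i _; apply: measurableI.
have mA2' i : measurable (\bigcup_(j < k) C i j) by apply: bigcup_measurable.
have mA2 : measurable A2 by apply: bigcup_measurable.
apply: (@le_trans _ _ (P (A1 `|` A2))).
  rewrite le_measure// ?inE; [exact: measurableI|exact: measurableU|].
  move=> x [/= uW Dk].
  have [[i ik vi]|[i [j [ik jk ji si sj]]]] :=
    one_or_two_branches v0 s0 (u := u) (x := x) ltac:(by rewrite Dk) uW; rewrite Dk in ik.
    by left; exists i => //; split.
  rewrite Dk in jk; right; exists i => //; exists j => //.
  by rewrite /C ji; split.
apply: (@le_trans _ _ (P A1 + P A2)); first exact: measureU2.
rewrite mulrDl EFinD; apply: leeD.
  by rewrite -mulrA; apply: union_bound => i; [exact: measurableI|apply: eq_lee; exact: PY].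
rewrite [(k%:R ^+ 2)%R]expr2 -!mulrA; apply: union_bound => // i; apply: union_bound => // j.
rewrite mulrA -expr2 /C; case: ifPn => ji; first by apply: eq_lee; exact: PYY.
by rewrite measure0 lee_fin mulr_ge0 ?sqr_ge0 ?offspring_prob_ge0.
Qed.

(** A cruder bound that keeps only one term: a sum of [k] terms exceeding
    [u - 1] has a term exceeding [(u - 1) / k]. It serves where nothing is known
    yet about the tails. *)
Lemma tail_pigeonhole_k (u : R) k : (1 <= u)%R ->
  P ([set x | u%:E < W x] `&` D k) <=
  (k%:R * g ((u - 1) / k%:R) * offspring_prob h k)%:E.
Proof.
move=> u1; pose A1 := \bigcup_(i < k) (Y i ((u - 1) / k%:R) `&` D k).
apply: (@le_trans _ _ (P A1)).
  rewrite le_measure// ?inE; first exact: measurableI.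
    by apply: bigcup_measurable => i _; apply: measurableI.
  move=> x [/= uW Dk]; apply: contrapT => noi.
  move: uW; rewrite W_rec Dk; apply/negP; rewrite -leNgt.
  apply: (@le_trans _ _ (1 + \sum_(i < k) ((u - 1) / k%:R)%:E)).
    rewrite leeD2l//; apply: lee_sum => i _; rewrite leNgt; apply/negP => hi.
    by apply: noi; exists i => //=; split.
  rewrite sumEFin sumr_const card_ord -EFinD lee_fin -[X in (1 + X <= _)%R]mulr_natr.
  case: (k) => [|n]; first by rewrite mulr0 addr0.
  by rewrite mulfVK ?pnatr_eq0// addrC subrK.
by rewrite -mulrA; apply: union_bound => i; [exact: measurableI|apply: eq_lee; exact: PY].
Qed.

Lemma tail_ge_branch (u : R) k : (0 < k)%N ->
  (g u * offspring_prob h k)%:E <= P [set x | u%:E < W x].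
Proof.
move=> k0; rewrite -(PY 0%N); apply: le_measure; rewrite ?inE//; first exact: measurableI.
move=> x [/= Yi Dk]; apply: lt_le_trans Yi _; apply: W_ge_branch.
by rewrite Dk.
Qed.

Lemma tail_decomposition (u : R) :
  P [set x | u%:E < W x] = \sum_(k <oo) P ([set x | u%:E < W x] `&` D k).
Proof. exact: root_decomposition. Qed.

End tail_inequalities.

(** * The tilted bias law *)

Section support.
Variables (R : realType) (nu : probability R R).

(** The real line is second countable: the null open intervals with rational
    endpoints cover the complement of the support. *)
Lemma msupport_subset_full (S : set R) : measurable S -> msupport nu `<=` S ->
  nu (~` S) = 0.
Proof.
move=> mS suppS.
pose J (n : nat) : set R := match unpickle n with
  | Some (r1, r2) => let A := `](ratr r1 : R), (ratr r2 : R)[%classic in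
      if nu A == 0 then A else set0
  | None => set0 end.
have mJ n : measurable (J n).
  rewrite /J; case: unpickle => [[r1 r2]|]; last exact: measurable0.
  by case: eqP => [_|_]; [exact: measurable_itv|exact: measurable0].
have J0 n : nu (J n) = 0.
  rewrite /J; case: unpickle => [[r1 r2]|]; last exact: measure0.
  by case: eqP => [h0|_]; [exact: h0|exact: measure0].
have : nu.-negligible (\bigcup_n J n).
  by apply: negligible_bigcup => n; apply/negligibleP; [exact: mJ|exact: J0].
move=> hN; suff sub : ~` S `<=` \bigcup_n J n.
  by apply/negligibleP; [exact: measurableC|exact: negligibleS sub hN].
move=> y Sy.
have [U [oU Uy U0]] : exists U : set R, [/\ open U, U y & nu U = 0].
  apply: contrapT => noU; apply: Sy; apply: suppS => U oU Uy.
  by rewrite lt_neqAle measure_ge0 andbT eq_sym; apply/eqP => U0; apply: noU; exists U.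
have [e /= e0 eU] := (nbhs_ballP y U).1 (open_nbhs_nbhs (conj oU Uy)).
have [r1] := rat_in_itvoo (x := (y - e)%R) (y := y) ltac:(lra).
have [r2] := rat_in_itvoo (x := y) (y := (y + e)%R) ltac:(lra).
rewrite !in_itv/= => /andP[r2a r2b] /andP[r1a r1b].
have [n nE] : exists n, unpickle n = Some (r1, r2).
  by exists (pickle (r1, r2)); exact: pickleK.
exists n => //; rewrite /J nE /=.
have JU : `](ratr r1 : R), (ratr r2 : R)[%classic `<=` U.
  move=> z /=; rewrite in_itv/= => /andP[z1 z2]; apply: eU.
  by rewrite /ball/= ltr_norml; apply/andP; split; lra.
set A := `]_, _[%classic in JU *.
have nuA : nu A = 0.
  apply/eqP; rewrite eq_le measure_ge0 andbT -U0; apply: le_measure => //.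
  - by rewrite inE; exact: measurable_itv.
  - by rewrite inE; exact: open_measurable.
by case: eqP => // _; rewrite /A /= in_itv/= r1b.
Qed.

End support.

Section tilted.
Variables (R : realType) (nu : probability R R) (q Q chi m : R).
Hypotheses (q1 : (1 < q)%R) (chi0 : (0 < chi)%R) (m0 : (0 < m)%R).
Hypothesis nu_supp : msupport nu `<=` [set y | q <= y <= Q]%R.
Hypothesis hchi :
  \int[nu]_(y in [set y : R | (1 < y)%R]) (y `^ chi)%:E = (m^-1)%:E.

Let I : set R := [set y | q <= y <= Q]%R.
Let w (y : R) : \bar R := (y `^ chi)%:E.

Let IE : I = `[q, Q]%classic.
Proof. by apply/seteqP; split => y /=; rewrite in_itv. Qed.

Let mI : measurable I. Proof. by rewrite IE. Qed.

Let nuI : nu (~` I) = 0.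
Proof. exact: msupport_subset_full. Qed.

Let mw (A : set R) : measurable_fun A w.
Proof. by apply/measurable_EFinP; apply: measurable_funTS; exact: measurable_powR. Qed.

Let w0 y : 0 <= w y. Proof. by rewrite lee_fin powR_ge0. Qed.

(** The tilted probability of [J], up to the factor [m]. *)
Definition tilted_mass (J : set R) : \bar R := \int[nu]_(y in I `&` J) w y.

Lemma integral_supp (k : R -> \bar R) (D : set R) :
  measurable D -> I `<=` D -> measurable_fun D k -> (forall y, 0 <= k y) ->
  \int[nu]_(y in D) k y = \int[nu]_(y in I) k y.
Proof.
move=> mD ID mk k0; rewrite (ge0_negligible_integral (measurableC mI))//.
by congr (integral nu _ k); rewrite setDE setCK; apply/setIidPr.
Qed.

(** This is where [chi] enters: [m * y ^ chi] is a probability density. *)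
Lemma tilted_massT : tilted_mass setT = (m^-1)%:E.
Proof.
rewrite /tilted_mass setIT -hchi; apply/esym/integral_supp => //.
  by rewrite (_ : [set y | _] = `]1%R, +oo[%classic)//; apply/seteqP; split => y /=;
    rewrite in_itv/= andbT.
by move=> y /andP[qy _] /=; apply: lt_le_trans qy.
Qed.

Lemma tilted_mass_split J : measurable J ->
  tilted_mass (~` J) + tilted_mass J = (m^-1)%:E.
Proof.
move=> mJ; rewrite -tilted_massT /tilted_mass -ge0_integral_setU//.
- by rewrite -setIUr setUC setUv.
- by apply: measurableI => //; exact: measurableC.
- exact: measurableI.
- by apply/disj_setPS => y [[_ +] [_]].
Qed.

Lemma tilted_mass_fin J : measurable J -> tilted_mass J \is a fin_num.
Proof.
move=> mJ; rewrite ge0_fin_numE; last exact: integral_ge0.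
rewrite (@le_lt_trans _ _ (m^-1)%:E) ?ltry// -(tilted_mass_split mJ) leeDr//.
exact: integral_ge0.
Qed.

Lemma tilted_mass_supp (s : R) (J : set R) : msupport nu s -> open J -> J s ->
  0 < tilted_mass J.
Proof.
move=> ns oJ Js; have mJ := open_measurable oJ.
apply: (@lt_le_trans _ _ (\int[nu]_(y in I `&` J) cst 1 y)); last first.
  apply: ge0_le_integral => //; first exact: measurableI.
  move=> y [/andP[qy _] _]; rewrite lee_fin -(powRr0 y) ler_powR//.
    by apply: le_trans (ltW q1) qy.
  exact: ltW.
rewrite integral_cst ?mul1e; last exact: measurableI.
have : 0 < nu J by exact: ns.
suff -> : nu J = nu (I `&` J) by [].
have z : nu (J `\` I) = 0.
  apply/eqP; rewrite eq_le measure_ge0 andbT -nuI; apply: le_measure.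
  - by rewrite inE; exact: measurableD.
  - by rewrite inE; exact: measurableC.
  - by move=> y [].
have e : nu J = nu (J `\` I) + nu (J `&` I) by exact: measureDI.
by rewrite e z add0e setIC.
Qed.

Lemma integral_le_tilted (k : R -> \bar R) (J : set R) (c1 c2 : R) :
  measurable J -> measurable_fun setT k -> (forall y, 0 <= k y) ->
  (0 <= c1)%R -> (0 <= c2)%R ->
  (forall y, I y -> k y <= (c1 * y `^ chi)%:E) ->
  (forall y, I y -> J y -> k y <= (c2 * y `^ chi)%:E) ->
  \int[nu]_y k y <= (c1 * (m^-1 - fine (tilted_mass J)) + c2 * fine (tilted_mass J))%:E.
Proof.
move=> mJ mk k0 c10 c20 k1 k2.
rewrite (integral_supp (D := setT))// -[I]setIT -(setUv J) setUC setIUr.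
rewrite ge0_integral_setU//; last 4 first.
- by apply: measurableI => //; exact: measurableC.
- exact: measurableI.
- exact: measurable_funTS.
- by apply/disj_setPS => y [[_ +] [_]].
have key (A : set R) (c : R) : measurable A -> (0 <= c)%R ->
    (forall y, I y -> A y -> k y <= (c * y `^ chi)%:E) ->
    \int[nu]_(y in I `&` A) k y <= c%:E * tilted_mass A.
  move=> mA c0 kc; rewrite /tilted_mass -ge0_integralZl_EFin//; last exact: measurableI.
  apply: ge0_le_integral => //.
  - exact: measurableI.
  - exact: measurable_funTS.
  - by apply: measurable_funeM.
  - by move=> y [Iy Ay]; rewrite -EFinM; exact: kc.
apply: (le_trans (leeD (key _ c1 (measurableC mJ) c10 (fun y Iy _ => k1 y Iy))
  (key _ c2 mJ c20 k2))).
have split := tilted_mass_split mJ.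
have f1 := tilted_mass_fin mJ; have f2 := tilted_mass_fin (measurableC mJ).
move: split; rewrite -(fineK f1) -(fineK f2) -!EFinM -!EFinD => -[E].
by rewrite lee_fin -E addrK.
Qed.

Lemma integral_ge_tilted (k : R -> \bar R) (c : R) :
  measurable_fun setT k -> (forall y, 0 <= k y) -> (0 <= c)%R ->
  (forall y, I y -> (c * y `^ chi)%:E <= k y) ->
  (c * m^-1)%:E <= \int[nu]_y k y.
Proof.
move=> mk k0 c0 kc; rewrite (integral_supp (D := setT))// EFinM -tilted_massT.
rewrite /tilted_mass setIT -ge0_integralZl_EFin//.
apply: ge0_le_integral => //.
- by move=> y _; rewrite mule_ge0.
- by apply: measurable_funeM.
- exact: measurable_funTS.
Qed.

End tilted.

(** * Tails of the weight and of a branch *)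

Section power_tails.
Variables (R : realType) (h : probability nat R) (nu : probability R R).
Variables (q Q chi m : R).
Hypotheses (q1 : (1 < q)%R) (chi0 : (0 < chi)%R) (m0 : (0 < m)%R).
Hypothesis nu_supp : msupport nu `<=` [set y | q <= y <= Q]%R.
Hypothesis hchi :
  \int[nu]_(y in [set y : R | (1 < y)%R]) (y `^ chi)%:E = (m^-1)%:E.
Variable P : probability (config R) R.
Hypothesis HP : realizes h nu P id.

Definition tail_prob (V : config R -> \bar R) (t : R) : R :=
  fine (P [set x | t%:E < V x]).

Section tail_theory.
Variable V : config R -> \bar R.
Hypothesis mV : measurable_fun setT V.

Lemma tailE t : P [set x | t%:E < V x] = (tail_prob V t)%:E.
Proof. by rewrite fineK//; apply: fin_num_measure; exact: measurable_egt. Qed.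

Lemma tail_ge0 t : (0 <= tail_prob V t)%R.
Proof. by rewrite fine_ge0. Qed.

Lemma tail_le1 t : (tail_prob V t <= 1)%R.
Proof. by rewrite -lee_fin -tailE; apply: probability_le1; exact: measurable_egt. Qed.

Lemma tail_noninc (s t : R) : (s <= t)%R -> (tail_prob V t <= tail_prob V s)%R.
Proof.
move=> st; rewrite -lee_fin -!tailE; apply: le_measure.
- by rewrite inE; exact: measurable_egt.
- by rewrite inE; exact: measurable_egt.
- by move=> x /=; apply: le_lt_trans; rewrite lee_fin.
Qed.

Lemma scaled_tailE (t y : R) : (0 < y)%R ->
  P [set x | t%:E < (`|y|%R)%:E * V x] = (tail_prob V (t / y))%:E.
Proof.
move=> y0; rewrite -tailE; congr (P _); apply/seteqP; split => x /=;
  by rewrite gtr0_norm// -lte_pdivrMl// EFinM muleC.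
Qed.

Lemma branch_tail_le (t c1 c2 : R) (J : set R) : measurable J ->
  (0 <= c1)%R -> (0 <= c2)%R ->
  (forall y : R, (q <= y <= Q)%R -> tail_prob V (t / y) <= c1 * y `^ chi)%R ->
  (forall y : R, (q <= y <= Q)%R -> J y -> tail_prob V (t / y) <= c2 * y `^ chi)%R ->
  (m * branch_tail nu P V t <= c1 * (1 - m * fine (tilted_mass nu q Q chi J)) +
    c2 * (m * fine (tilted_mass nu q Q chi J)))%R.
Proof.
move=> mJ c10 c20 k1 k2.
have Iy y : (q <= y <= Q)%R -> (0 < y)%R.
  by move=> /andP[qy _]; rewrite (lt_le_trans _ qy)// (lt_trans ltr01 q1).
have := @integral_le_tilted _ _ _ _ _ _ q1 nu_supp hchi _ J c1 c2 mJ
  (measurable_branch_section P mV t) (fun y => measure_ge0 _ _) c10 c20.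
move=> /(_ _ _)/wrap[|y yI|]; first by move=> y yI; rewrite scaled_tailE ?lee_fin ?k1// Iy.
  by move=> Jy; rewrite scaled_tailE ?lee_fin ?k2// Iy.
rewrite -/(ebranch_tail nu P V t) (branch_tailE HP mV) lee_fin => H.
have := ler_wpM2l (ltW m0) H; set s := fine _; move/le_trans; apply.
by rewrite le_eqVlt; apply/orP; left; apply/eqP; field; exact: lt0r_neq0.
Qed.

Lemma branch_tail_ge (t c : R) : (0 <= c)%R ->
  (forall y : R, (q <= y <= Q)%R -> c * y `^ chi <= tail_prob V (t / y))%R ->
  (c <= m * branch_tail nu P V t)%R.
Proof.
move=> c0 kc.
have Iy y : (q <= y <= Q)%R -> (0 < y)%R.
  by move=> /andP[qy _]; rewrite (lt_le_trans _ qy)// (lt_trans ltr01 q1).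
have := @integral_ge_tilted _ _ _ _ _ _ q1 nu_supp hchi _ c
  (measurable_branch_section P mV t) (fun y => measure_ge0 _ _) c0.
move=> /(_ _)/wrap[y yI|]; first by rewrite scaled_tailE ?lee_fin ?kc// Iy.
rewrite -/(ebranch_tail nu P V t) (branch_tailE HP mV) lee_fin => H.
by rewrite -ler_pdivrMl// mulrC.
Qed.

End tail_theory.
End power_tails.

Section summed_inequalities.
Variables (R : realType) (h : probability nat R) (nu : probability R R).
Hypothesis htail : exists2 c : R, (0 < c)%R &
  forall k : nat, \sum_(k <= l <oo) h [set l] <= (expR (- (c * k%:R)))%:E.
Variable P : probability (config R) R.
Hypothesis HP : realizes h nu P id.
Variables V W : config R -> \bar R.
Hypothesis mV : measurable_fun setT V.
Hypothesis mW : measurable_fun setT W.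
Hypothesis V0 : forall x, 0 <= V x.
Hypothesis W_rec : forall x, W x = 1 + \sum_(i < root_degree x) branch V i x.

Lemma tail_sum_le (u A B : R) n : (0 <= A)%R -> (0 <= B)%R ->
  (forall k, P ([set x | u%:E < W x] `&` [set x | root_degree x = k]) <=
    ((k%:R * A + k%:R ^+ n * B) * offspring_prob h k)%:E) ->
  (tail_prob P W u <= moment h 1 * A + moment h n * B)%R.
Proof.
move=> A0 B0 H; rewrite -lee_fin -(tailE _ mW) (tail_decomposition P mW) EFinD.
rewrite -!(moment_seriesM htail)// -nneseriesD; last 2 first.
- by move=> k _ _; rewrite lee_fin !mulr_ge0 ?offspring_prob_ge0.
- by move=> k _ _; rewrite lee_fin !mulr_ge0 ?exprn_ge0 ?offspring_prob_ge0.
apply: lee_nneseries => [k _ _|k _]; first exact: measure_ge0.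
by rewrite -EFinD -mulrDl expr1; exact: H.
Qed.

Lemma tail_lower (u : R) : (moment h 1 * branch_tail nu P V u <=
  tail_prob P W u + moment h 2 * branch_tail nu P V u ^+ 2)%R.
Proof.
rewrite -lee_fin EFinD -(tailE _ mW) (tail_decomposition P mW).
have g0 := branch_tail_ge0 nu P V u.
rewrite -!(moment_seriesM htail)// ?sqr_ge0// -nneseriesD; last 2 first.
- by move=> k _ _; exact: measure_ge0.
- by move=> k _ _; rewrite lee_fin !mulr_ge0 ?exprn_ge0 ?offspring_prob_ge0 ?sqr_ge0.
apply: lee_nneseries => [k _ _|k _].
  by rewrite lee_fin !mulr_ge0 ?exprn_ge0 ?offspring_prob_ge0.
have := tail_ge_k HP mV mW V0 W_rec u k.
by rewrite expr1 [(k%:R * (_ * _))%R]mulrA [(k%:R ^+ 2 * (_ * _))%R]mulrA.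
Qed.

Lemma tail_pigeonhole (u A B : R) n : (1 <= u)%R -> (0 <= A)%R -> (0 <= B)%R ->
  (forall k, (0 < k)%N ->
    k%:R * branch_tail nu P V ((u - 1) / k%:R) <= k%:R * A + k%:R ^+ n * B)%R ->
  (tail_prob P W u <= moment h 1 * A + moment h n * B)%R.
Proof.
move=> u1 A0 B0 H; apply: tail_sum_le => // k.
apply: le_trans (tail_pigeonhole_k HP mV mW W_rec k u1) _.
rewrite lee_fin ler_wpM2r ?offspring_prob_ge0//; case: k => [|k]; last exact: H.
by rewrite !mul0r add0r mulr_ge0// exprn_ge0.
Qed.

Lemma tail_upper (u v r B : R) n : (0 <= v)%R -> (0 <= r)%R -> (v + r + 1 <= u)%R ->
  (0 <= B)%R -> (forall k, (0 < k)%N ->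
    k%:R ^+ 2 * branch_tail nu P V (r / k%:R) ^+ 2 <= k%:R ^+ n * B)%R ->
  (tail_prob P W u <= moment h 1 * branch_tail nu P V v + moment h n * B)%R.
Proof.
move=> v0 r0 vru B0 H; apply: tail_sum_le => //; first exact: branch_tail_ge0.
move=> k; apply: le_trans (tail_le_k HP mV mW W_rec (s := r / k%:R) v0 _ _) _.
- by rewrite divr_ge0.
- apply: le_trans vru; rewrite lerD2r lerD2l; case: k => [|k]; first by rewrite mul0r.
  by rewrite mulrC mulfVK// pnatr_eq0.
rewrite lee_fin ler_wpM2r ?offspring_prob_ge0//; case: k => [|k]; last by rewrite lerD2l H.
by rewrite expr0n !mul0r !add0r mulr_ge0// exprn_ge0.
Qed.

End summed_inequalities.

Local Close Scope ereal_scope.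

(** * A first power bound *)

Section weight_tail.
Variables (R : realType) (h : probability nat R) (nu : probability R R).
Variables (q Q chi : R).
Local Notation m := (moment h 1).
Hypotheses (q1 : 1 < q) (chi0 : 0 < chi) (m0 : 0 < m).
Hypothesis htail : exists2 c : R, 0 < c &
  forall k : nat, (\sum_(k <= l <oo) h [set l] <= (expR (- (c * k%:R)))%:E)%E.
Hypothesis nu_supp : msupport nu `<=` [set y | q <= y <= Q].
Hypothesis hchi :
  (\int[nu]_(y in [set y : R | (1 < y)%R]) (y `^ chi)%:E = (m^-1)%:E)%E.
Variable P : probability (config R) R.
Hypothesis HP : realizes h nu P id.

Lemma expR_div (x y : R) : 0 < y -> expR x / y = expR (x - ln y).
Proof. by move=> y0; rewrite expRB lnK. Qed.

Lemma powR_expR (y : R) : 0 < y -> y `^ chi = expR (chi * ln y).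
Proof. by move=> y0; rewrite /powR gt_eqF. Qed.

(** For [y >= q] we have [y ^ p <= q ^ (p - chi) * y ^ chi], and [m * y ^ chi] has
    integral 1; the factor [q ^ (p - chi)] is a gain when [p < chi]. *)
Lemma branch_tail_power (V : config R -> \bar R) (K p x : R) :
  measurable_fun setT V -> 0 <= K -> p <= chi ->
  (forall x : R, tail_prob P V (expR x) <= K * expR (- (p * x))) ->
  m * branch_tail nu P V (expR x) <= K * expR ((p - chi) * ln q) * expR (- (p * x)).
Proof.
move=> mV K0 pchi VK; set c := _ * _ * _.
have c0 : 0 <= c by rewrite !mulr_ge0 ?expR_ge0.
have bound (y : R) : q <= y <= Q -> tail_prob P V (expR x / y) <= c * y `^ chi.
  move=> /andP[qy _]; have y0 : 0 < y by rewrite (lt_le_trans _ qy)// (lt_trans ltr01 q1).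
  rewrite expR_div// powR_expR//; apply: le_trans (VK _) _.
  rewrite /c -!mulrA ler_wpM2l// -!expRD ler_expR.
  have : 0 <= (chi - p) * (ln y - ln q).
    rewrite mulr_ge0 ?subr_ge0// ler_ln ?posrE// (lt_trans ltr01 q1)//.
  by lra.
have := @branch_tail_le _ _ _ _ _ _ _ q1 m0 nu_supp hchi _ HP _ mV (expR x) c c setT
  measurableT c0 c0 bound (fun y yI _ => bound y yI).
by move/le_trans; apply; rewrite le_eqVlt; apply/orP; left; apply/eqP; ring.
Qed.

(** The tree is the increasing union of its truncations. *)
Lemma tail_weight_lim (u c : R) :
  (forall n, tail_prob P (@weight_upto R n) u <= c) -> tail_prob P (@weight R) u <= c.
Proof.
move=> H; rewrite -lee_fin -(tailE P (@measurable_weight R)).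
pose E n := [set x : config R | (u%:E < weight_upto n x)%E].
have mE n : measurable (E n) by apply: measurable_egt; exact: measurable_weight_upto.
have -> : [set x : config R | (u%:E < weight x)%E] = \bigcup_n E n.
  by apply/seteqP; split => [x /= /weight_gt_upto[n un]|x [n _] /= un];
    [exists n|apply/weight_gt_upto; exists n].
have := nondecreasing_cvg_mu (mu := P) mE (bigcupT_measurable _ mE).
move=> /(_ _)/wrap[|cv].
  move=> i j ij; apply/subsetPset => x /= ux; apply: lt_le_trans ux _.
  exact: weight_upto_nd.
rewrite -(cvg_lim _ cv)//; apply: lime_le; first by apply/cvg_ex; eexists; exact: cv.
apply: nearW => n /=; rewrite (tailE P (@measurable_weight_upto R n)) lee_fin.
exact: H.
Qed.

(** By induction on the height, the tail at [exp x] is at most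
    [K * exp (- p x)]: the threshold [(u - 1) / k] for a branch multiplies [K]
    by [q ^ (p - chi) * E N^(1 + p) / m], up to a factor that is close to 1 for
    large [u]. As [p] tends to 0 this ratio tends to [q ^ (- chi) < 1], since
    [E N^(1 + p) <= m + p * E N^3]. *)
Lemma tail_init : exists K p : R, [/\ 0 < p, p <= chi, 0 < K &
  forall x : R, tail_prob P (@weight R) (expR x) <= K * expR (- (p * x))].
Proof.
have [chi0' m0'] : 0 < chi /\ 0 < m by [].
have a0 : 0 < ln q by rewrite ln_gt0.
set a := ln q in a0; set M := moment h 3; have M0 : 0 <= M := moment_ge0 h 3.
have E0 : 1 < expR (chi / 2 * a) by rewrite expR_gt1 mulr_gt0//; lra.
pose g := expR (chi / 2 * a) - 1; have g0 : 0 < g by rewrite /g; lra.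
have gE : expR (chi / 2 * a) = 1 + g by rewrite /g; lra.
(* with this [p], the ratio above is at most [rho] *)
pose p := Num.min 1 (Num.min (chi / 2) (g / 2 * m / (1 + M))).
have p0 : 0 < p.
  rewrite !lt_min ltr01/=; apply/andP; split; first lra.
  by rewrite divr_gt0 ?mulr_gt0//; lra.
have [p1 [pchi pg]] : p <= 1 /\ p <= chi / 2 /\ p <= g / 2 * m / (1 + M).
  by rewrite !ge_min !lexx !orbT.
have pM : p * M <= g / 2 * m.
  move: pg; rewrite ler_pdivlMr; last lra.
  by lra.
pose rho := (1 + g / 2) / (1 + g).
have rho0 : 0 < rho by rewrite divr_gt0//; lra.
have rho1 : rho < 1 by rewrite ltr_pdivrMr; lra.
have rhoE : rho * (1 + g) = 1 + g / 2 by rewrite mulfVK// lt0r_neq0//; lra.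
(* [u - 1 >= u * exp (- d)] for large [u], and [exp (p * d)] absorbs [rho] *)
pose d := - ln rho / p.
have d0 : 0 < d by rewrite divr_gt0// oppr_gt0 ln_lt0// rho0.
have pd : expR (p * d) * rho = 1.
  have -> : p * d = - ln rho by rewrite /d mulrC mulfVK// lt0r_neq0.
  by rewrite expRN lnK ?posrE// mulVf// lt0r_neq0.
have ed : 0 < 1 - expR (- d) by rewrite subr_gt0 expR_lt1; lra.
have [x1 x10 Hx1] := @expRN_small _ 1 (1 - expR (- d)) ltr01 ed.
pose K := expR (p * x1); have K0 : 0 < K by exact: expR_gt0.
exists K, p; split => //; first lra.
move=> x; apply: tail_weight_lim => n; elim: n x => [|n IH] x.
  have mW0 := @measurable_weight_upto R 0.
  case: (leP x 0) => x0.
    apply: (le_trans (tail_le1 P mW0 _)); rewrite /K -expRD -expR0 ler_expR.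
    by rewrite -mulrBr mulr_ge0 ?(ltW p0)//; lra.
  rewrite /tail_prob (_ : [set _ | _] = set0) ?measure0/= ?mulr_ge0 ?expR_ge0//.
  apply/seteqP; split => // y /=; rewrite weight_upto0 lte_fin.
  by rewrite ltNge => /negP; apply; rewrite -expR0 ler_expR ltW.
have mV := @measurable_weight_upto R n; have mW := @measurable_weight_upto R n.+1.
case: (leP x x1) => [xx1|x1x].
  apply: (le_trans (tail_le1 P mW _)); rewrite /K -expRD -expR0 ler_expR.
  by rewrite -mulrBr mulr_ge0 ?(ltW p0)//; lra.
have x0 : 0 <= x by lra.
pose c := K * expR ((p - chi) * a) * expR (- (p * (x - d))) / m.
have c0 : 0 <= c by rewrite !mulr_ge0 ?expR_ge0 ?invr_ge0 ?ltW.
have u1 : 1 <= expR x by rewrite -expR0 ler_expR.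
have ud : expR (x - d) <= expR x - 1.
  have := Hx1 x (ltW x1x); rewrite mul1r => e1.
  have := ler_wpM2l (expR_ge0 x) e1; rewrite mulrBr -!expRD subrr expR0 mulr1; lra.
have := @tail_pigeonhole _ _ nu htail P HP _ _ mV mW (weight_uptoS n) (expR x)
   c (p * c) 3 u1 c0 (mulr_ge0 (ltW p0) c0).
move=> /(_ _)/wrap[k k0|].
  have kpos : 0 < k%:R :> R by rewrite ltr0n.
  have lk : 0 <= ln (k%:R : R) by rewrite ln_ge0// ler1n.
  (* k ^ p <= 1 + p k ^ 2, linear in p *)
  have kp : expR (p * ln k%:R) <= 1 + p * k%:R ^+ 2 :> R.
    apply: le_trans (expR_le_1D _) _; rewrite lerD2l -mulrA ler_wpM2l ?(ltW p0)//.
    rewrite expr2; apply: ler_pM; rewrite ?expR_ge0//.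
      by apply: ltW; exact: ln_sublinear.
    rewrite -[leRHS](lnK (x := k%:R)) ?posrE// ler_expR.
    by have : 0 <= (1 - p) * ln k%:R; [rewrite mulr_ge0// subr_ge0|lra].
  have u0 : 0 < (expR x - 1) / k%:R.
    by rewrite divr_gt0//; apply: lt_le_trans ud; exact: expR_gt0.
  have bt : branch_tail nu P (weight_upto n) ((expR x - 1) / k%:R) <= c * expR (p * ln k%:R).
    rewrite -(lnK (x := (expR x - 1) / k%:R)) ?posrE//.
    set y := ln _.
    have yge : x - d - ln k%:R <= y.
      rewrite -ler_expR lnK ?posrE// expRB lnK ?posrE//.
      by rewrite ler_pM2r ?invr_gt0.
    have := @branch_tail_power _ K p y mV (ltW K0) ltac:(lra) IH.
    rewrite -ler_pdivlMl// => /le_trans; apply.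
    have -> : c * expR (p * ln k%:R) = m^-1 * (K * expR ((p - chi) * a) *
        (expR (- (p * (x - d))) * expR (p * ln k%:R))) by rewrite /c; ring.
    rewrite ler_wpM2l ?invr_ge0 ?(ltW m0)// ler_wpM2l ?mulr_ge0 ?expR_ge0//.
    rewrite -expRD ler_expR.
    have : 0 <= p * (y - (x - d - ln k%:R)) by rewrite mulr_ge0 ?subr_ge0// ltW.
    by lra.
  apply: (@le_trans _ _ (k%:R * (c * (1 + p * k%:R ^+ 2)))).
    rewrite ler_wpM2l ?(ltW kpos)//; apply: le_trans bt _.
    by rewrite ler_wpM2l.
  by rewrite le_eqVlt; apply/orP; left; apply/eqP; ring.
move/le_trans; apply; rewrite -/M.
have -> : m * c + M * (p * c) = c * (m + p * M) by ring.
have e1 : expR ((p - chi) * a) * (1 + g) <= 1.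
  rewrite -gE -expRD expR_le1.
  have : 0 <= (chi / 2 - p) * a by rewrite mulr_ge0 ?subr_ge0// ltW.
  by lra.
have e2 : expR ((p - chi) * a) * (m + p * M) / m <= rho.
  rewrite ler_pdivrMr// /rho -mulrAC ler_pdivlMr; last lra.
  have : m + p * M <= (1 + g / 2) * m by lra.
  have e0 := expR_ge0 ((p - chi) * a).
  move=> e3; have := ler_wpM2l e0 e3 => e4.
  have g10 : 0 <= 1 + g by lra.
  have := ler_wpM2r g10 e4 => /le_trans; apply.
  have mg : 0 <= (1 + g / 2) * m by rewrite mulr_ge0//; lra.
  have := ler_wpM2r mg e1; lra.
have -> : c * (m + p * M) = K * expR (- (p * x)) *
    (expR (p * d) * (expR ((p - chi) * a) * (m + p * M) / m)).
  rewrite /c mulrBr opprB expRD addrC; field; exact: lt0r_neq0.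
rewrite -[leRHS]mulr1 -pd ler_wpM2l ?mulr_ge0 ?expR_ge0 ?(ltW K0)//.
by rewrite ler_wpM2l ?expR_ge0.
Qed.

End weight_tail.

(** * The weight satisfies an approximate renewal equation *)

Section weight_renewal.
Variables (R : realType) (h : probability nat R) (nu : probability R R).
Variables (q Q chi : R).
Local Notation m := (moment h 1).
Hypotheses (q1 : 1 < q) (qQ : q < Q) (chi0 : 0 < chi) (m0 : 0 < m).
Hypothesis htail : exists2 c : R, 0 < c &
  forall k : nat, (\sum_(k <= l <oo) h [set l] <= (expR (- (c * k%:R)))%:E)%E.
Hypothesis nu_supp : msupport nu `<=` [set y | q <= y <= Q].
Hypothesis hchi :
  (\int[nu]_(y in [set y : R | (1 < y)%R]) (y `^ chi)%:E = (m^-1)%:E)%E.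
Variable P : probability (config R) R.
Hypothesis HP : realizes h nu P id.

Local Notation W := (@weight R).
Local Notation G := (tail_prob P W).
Local Notation g := (branch_tail nu P W).

Definition scaled_tail (x : R) : R := expR (chi * x) * tail_prob P W (expR x).
Definition scaled_branch_tail (x : R) : R :=
  expR (chi * x) * (m * branch_tail nu P W (expR x)).

Local Notation f := scaled_tail.
Local Notation F := scaled_branch_tail.

Let mW := @measurable_weight R.

Lemma scaled_tailK (x : R) : G (expR x) = expR (- (chi * x)) * f x.
Proof. by rewrite /f mulrA -expRD addNr expR0 mul1r. Qed.

Lemma supp_gt0 (y : R) : q <= y -> 0 < y.
Proof. by move=> qy; rewrite (lt_le_trans _ qy)// (lt_trans ltr01 q1). Qed.

Lemma supp_ln (y : R) : q <= y <= Q -> ln q <= ln y <= ln Q.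
Proof.
by move=> /andP[qy yQ]; rewrite !ler_ln ?posrE ?qy ?yQ// ?supp_gt0// (le_trans qy).
Qed.

Lemma tail_divE (x y : R) : 0 < y ->
  G (expR x / y) = expR (- (chi * x)) * f (x - ln y) * y `^ chi.
Proof.
move=> y0; rewrite expR_div// scaled_tailK powR_expR// mulrAC -expRD.
by congr (expR _ * _); ring.
Qed.

Lemma tail_lt1 (x : R) : x < 0 -> G (expR x) = 1.
Proof.
move=> x0; rewrite /tail_prob (_ : [set _ | _] = setT) ?probability_setT//.
apply/seteqP; split => // y _ /=; apply: lt_le_trans (weight_ge1 y).
by rewrite lte_fin expR_lt1.
Qed.

Lemma scaled_branch_tail_ge (x c : R) :
  (forall z : R, ln q <= z <= ln Q -> c <= f (x - z)) -> c <= F x.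
Proof.
move=> cf; case: (leP c 0) => c0.
  apply: le_trans c0 _; rewrite /F !mulr_ge0 ?expR_ge0 ?(ltW m0)//.
  exact: branch_tail_ge0.
have := @branch_tail_ge _ _ _ _ _ _ _ q1 m0 nu_supp hchi _ HP _ mW (expR x)
  (expR (- (chi * x)) * c) ltac:(by rewrite mulr_ge0 ?expR_ge0// ltW).
move=> /(_ _)/wrap[y yI|].
  rewrite tail_divE ?supp_gt0//; last by case/andP: yI.
  rewrite ler_wpM2r ?powR_ge0// ler_wpM2l ?expR_ge0//; apply: cf.
  exact: supp_ln.
move=> H; rewrite /F -[leLHS](mul1r c) -(expR0 R) -(addrN (chi * x)) expRD -mulrA.
by rewrite ler_wpM2l ?expR_ge0.
Qed.

Lemma offspring_pos : exists2 k, (0 < k)%N & 0 < offspring_prob h k.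
Proof.
apply: contrapT => nok; have : m = 0.
  apply: EFin_inj; rewrite -(moment_series htail) eseries0// => k _ _.
  case: k => [|k]; first by rewrite expr1 mul0r.
  rewrite (_ : offspring_prob h k.+1 = 0) ?mulr0//; apply/eqP.
  rewrite eq_le offspring_prob_ge0 andbT leNgt; apply/negP => mk.
  by apply: nok; exists k.+1.
by move=> m_eq0; move: m0; rewrite m_eq0 ltxx.
Qed.

(** The tail is 1 below 1, and one generation multiplies its argument by at
    least [q] at the price of a positive factor. *)
Lemma scaled_tail_gt0 (x : R) : 0 < f x.
Proof.
have a0 : 0 < ln q by rewrite ln_gt0.
have [k k0 mk] := offspring_pos.
rewrite mulr_gt0 ?expR_gt0//.
have neg y : y < 0 -> 0 < G (expR y) by move=> y0; rewrite tail_lt1.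
case: (ltP x 0) => [/neg //|x0].
move: x x0; apply: (@scale_ind _ (ln q) 0 (- 1)) => //.
  by move=> x /andP[]; lra.
move=> x _ IH.
have Gq : 0 < G (expR (x - ln q)).
  case: (ltP (x - ln q) 0) => [/neg //|xq]; apply: IH.
  by rewrite xq lexx.
have Qp : 0 < Q `^ chi by rewrite powR_gt0// supp_gt0// ltW.
have gp : 0 < m * g (expR x).
  apply: (@lt_le_trans _ _ (G (expR (x - ln q)) / Q `^ chi)).
    by rewrite divr_gt0.
  apply: (@branch_tail_ge _ _ _ _ _ _ _ q1 m0 nu_supp hchi _ HP _ mW).
    by rewrite divr_ge0// ltW.
  move=> y /andP[qy yQ]; have y0 := supp_gt0 qy.
  rewrite mulrAC ler_pdivrMr//; apply: ler_pM; rewrite ?tail_ge0 ?powR_ge0//.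
    apply: (tail_noninc P mW); rewrite expR_div// ler_expR lerB//.
    by rewrite ler_ln ?posrE// supp_gt0.
  by apply: ge0_ler_powR; rewrite ?nnegrE ?(ltW chi0) ?(ltW y0)// (le_trans (ltW y0)).
have := tail_ge_branch HP mW mW (@weight_ge0 R) (@weight_rec R) (expR x) k0.
rewrite (tailE P mW) lee_fin; apply: lt_le_trans; rewrite mulr_gt0//.
by move: gp; rewrite pmulr_rgt0.
Qed.

Lemma scaled_branch_tail_mix (x c1 c2 : R) (J : set R) :
  measurable J -> (exists2 y, q <= y <= Q & J y) ->
  (forall z : R, ln q <= z <= ln Q -> f (x - z) <= c1) ->
  (forall y : R, q <= y <= Q -> J y -> f (x - ln y) <= c2) ->
  F x <= c1 * (1 - m * fine (tilted_mass nu q Q chi J)) +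
         c2 * (m * fine (tilted_mass nu q Q chi J)).
Proof.
move=> mJ [y0 y0I Jy0] f1 f2.
have c10 : 0 < c1 := lt_le_trans (scaled_tail_gt0 _) (f1 _ (supp_ln y0I)).
have c20 : 0 < c2 := lt_le_trans (scaled_tail_gt0 _) (f2 _ y0I Jy0).
have e0 := expR_ge0 (- (chi * x)).
have Ec (c : R) : 0 < c -> 0 <= expR (- (chi * x)) * c by move=> c0; rewrite mulr_ge0// ltW.
have k1 y : q <= y <= Q -> G (expR x / y) <= expR (- (chi * x)) * c1 * y `^ chi.
  move=> yI; rewrite tail_divE ?supp_gt0//; last by case/andP: yI.
  by rewrite ler_wpM2r ?powR_ge0// ler_wpM2l// f1// supp_ln.
have k2 y : q <= y <= Q -> J y -> G (expR x / y) <= expR (- (chi * x)) * c2 * y `^ chi.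
  move=> yI Jy; rewrite tail_divE ?supp_gt0//; last by case/andP: yI.
  by rewrite ler_wpM2r ?powR_ge0// ler_wpM2l// f2.
have := @branch_tail_le _ _ _ _ _ _ _ q1 m0 nu_supp hchi _ HP _ mW (expR x)
  (expR (- (chi * x)) * c1) (expR (- (chi * x)) * c2) J mJ (Ec _ c10) (Ec _ c20) k1 k2.
move=> H; have := ler_wpM2l (expR_ge0 (chi * x)) H => /le_trans; apply.
have e1 : expR (chi * x) * expR (- (chi * x)) = 1 by rewrite -expRD addrN expR0.
set r := fine _; rewrite -[leRHS]mul1r -e1.
by rewrite le_eqVlt; apply/orP; left; apply/eqP; ring.
Qed.

Lemma scaled_branch_tail_le (x c : R) :
  (forall z : R, ln q <= z <= ln Q -> f (x - z) <= c) -> F x <= c.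
Proof.
move=> fc; have ne : exists2 y, q <= y <= Q & [set: R] y.
  by exists q => //; rewrite lexx ltW.
apply: (le_trans (scaled_branch_tail_mix measurableT ne fc (fun y yI _ => fc _ (supp_ln yI)))).
by rewrite le_eqVlt; apply/orP; left; apply/eqP; ring.
Qed.

Lemma tilted_prob_le1 (J : set R) : measurable J ->
  m * fine (tilted_mass nu q Q chi J) <= 1.
Proof.
move=> mJ; have fJ := tilted_mass_fin q1 nu_supp hchi mJ.
have := tilted_mass_split q1 nu_supp hchi mJ.
have fC := tilted_mass_fin q1 nu_supp hchi (measurableC mJ).
rewrite -(fineK fJ) -(fineK fC) -EFinD => -[E].
have C0 : 0 <= fine (tilted_mass nu q Q chi (~` J)).
  by rewrite fine_ge0// integral_ge0// => y _; rewrite lee_fin powR_ge0.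
rewrite mulrC -ler_pdivlMr// mul1r -E; lra.
Qed.

Lemma scaled_branch_tail_supp (s eta : R) : [set ln y | y in msupport nu] s -> 0 < eta ->
  exists2 p : R, 0 < p <= 1 & forall x c1 c2 : R,
    (forall z : R, ln q <= z <= ln Q -> f (x - z) <= c1) ->
    (forall z : R, ln q <= z <= ln Q -> `|z - s| < eta -> f (x - z) <= c2) ->
    F x <= c1 * (1 - p) + c2 * p.
Proof.
move=> [y0 sy0 <-] eta0; have y0I := nu_supp sy0.
have y00 : 0 < y0 by apply: supp_gt0; case/andP: y0I.
pose J : set R := `](expR (ln y0 - eta)), (expR (ln y0 + eta))[%classic.
have mJ : measurable J by exact: measurable_itv.
have oJ : open J by exact: interval_open.
have Jy0 : J y0.
  by rewrite /J /= in_itv/= -{2 3}(lnK (x := y0)) ?posrE// !ltr_expR; apply/andP; split; lra.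
exists (m * fine (tilted_mass nu q Q chi J)).
  rewrite tilted_prob_le1// andbT mulr_gt0// fine_gt0//.
  rewrite (tilted_mass_supp q1 chi0 nu_supp sy0 oJ Jy0) /=.
  rewrite -ge0_fin_numE ?(tilted_mass_fin q1 nu_supp hchi)//.
  by rewrite integral_ge0// => y _; rewrite lee_fin powR_ge0.
move=> x c1 c2 f1 f2; apply: scaled_branch_tail_mix => //; first by exists y0.
move=> y yI; rewrite /J /= in_itv/= => Jy; apply: f2; first exact: supp_ln.
have y_gt0 : 0 < y by apply: supp_gt0; case/andP: yI.
move: Jy; rewrite -{1 2}(lnK (x := y)) ?posrE// !ltr_expR => /andP[h1 h2].
by rewrite ltr_norml; apply/andP; split; lra.
Qed.

Lemma scaled_tail_lower : exists2 C : R, 0 <= C & forall x : R, 0 <= x ->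
  F x - C * expR (- (chi * x)) * F x ^+ 2 <= f x.
Proof.
exists (moment h 2 / m ^+ 2); first by rewrite divr_ge0 ?moment_ge0// sqr_ge0.
move=> x _; have := tail_lower htail HP mW mW (@weight_ge0 R) (@weight_rec R) (expR x).
move=> H; have := ler_wpM2l (expR_ge0 (chi * x)) H => {}H.
have -> : moment h 2 / m ^+ 2 * expR (- (chi * x)) * F x ^+ 2 =
    expR (chi * x) * (moment h 2 * g (expR x) ^+ 2).
  have e1 : expR (- (chi * x)) * expR (chi * x) = 1 by rewrite -expRD addNr expR0.
  transitivity (moment h 2 * g (expR x) ^+ 2 * expR (chi * x) *
      (expR (- (chi * x)) * expR (chi * x))); last by rewrite e1; ring.
  by rewrite /F; field; exact: lt0r_neq0.
by move: H; rewrite /F /f mulrDr; lra.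
Qed.

(** With [u = exp x], two branches of a vertex with [k] children count as large
    above [u^(3/4) / k]; the square of the tail there is of order
    [k^(2 p) * u^(- 3/2 p)], and [k^(2 p) <= k^n] as soon as [n >= 2 * chi]. What
    remains for the largest branch is [u - 1 - u^(3/4) >= u * exp (- 4 t)], where
    [t = u^(- 1/4) <= 1/4]. *)
Lemma scaled_tail_upper (e K : R) : 0 <= e < chi ->
  (forall x : R, 0 <= x -> f x <= K * expR (e * x)) ->
  exists2 C : R, 0 <= C & exists x0 : R, forall x : R, x0 <= x ->
    f x <= expR (4 * chi * expR (- (x / 4))) * F (x - 4 * expR (- (x / 4)))
           + C * expR ((chi - 3 / 2 * (chi - e)) * x).
Proof.
move=> /andP[e0 echi] fK; have [chi0' m0'] : 0 < chi /\ 0 < m by [].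
pose K1 := Num.max K 1; pose p := chi - e.
have K10 : 0 < K1 by rewrite lt_max ltr01 orbT.
have p0 : 0 < p by rewrite subr_gt0.
have pchi : p <= chi by rewrite /p; lra.
have GK (x : R) : G (expR x) <= K1 * expR (- (p * x)).
  case: (leP 0 x) => x0.
    rewrite scaled_tailK; apply: (@le_trans _ _ (expR (- (chi * x)) * (K * expR (e * x)))).
      by rewrite ler_wpM2l ?expR_ge0// fK.
    rewrite mulrCA -expRD; apply: ler_pM; rewrite ?expR_ge0//.
    - have := fK 0 (lexx 0); rewrite !mulr0 expR0 mulr1 => /(le_trans _); apply.
      exact: ltW (scaled_tail_gt0 0).
    - by rewrite le_max lexx.
    - by rewrite ler_expR /p; lra.
  apply: (le_trans (tail_le1 P mW _)); rewrite -[leLHS]mulr1; apply: ler_pM => //.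
    by rewrite le_max lexx orbT.
  rewrite -expR0 ler_expR.
  by have := mulr_gt0 p0 (_ : 0 < - x); rewrite oppr_gt0 => /(_ x0); lra.
have gK (x : R) : g (expR x) <= K1 / m * expR (- (p * x)).
  have := branch_tail_power q1 m0 nu_supp hchi HP x mW (ltW K10) pchi GK.
  rewrite -ler_pdivlMl// => /le_trans; apply.
  have E1 : expR ((p - chi) * ln q) <= 1.
    by rewrite expR_le1 -oppr_ge0 -mulNr opprB mulr_ge0 ?subr_ge0// ln_ge0// ltW.
  have M0 : 0 <= K1 / m * expR (- (p * x)).
    by rewrite mulr_ge0 ?expR_ge0// divr_ge0 ?ltW.
  have := ler_wpM2l M0 E1; rewrite mulr1; apply: le_trans.
  by rewrite le_eqVlt; apply/orP; left; apply/eqP; ring.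
pose n := (Num.truncn (2 * chi)).+1.
have kn k : (0 < k)%N -> expR (2 * p * ln k%:R) <= k%:R ^+ n :> R.
  move=> k0; have lk : 0 <= ln (k%:R : R) by rewrite ln_ge0// ler1n.
  rewrite -[in leRHS](lnK (x := k%:R)) ?posrE ?ltr0n// -expRM_natl ler_expR.
  rewrite ler_wpM2r//; apply: (@le_trans _ _ (2 * chi)); first lra.
  by apply: ltW; exact: truncnS_gt.
have C0 : 0 <= (K1 / m) ^+ 2 by exact: sqr_ge0.
exists (moment h (n + 2) * (K1 / m) ^+ 2); first by rewrite mulr_ge0// moment_ge0.
have [x0 x00 Hx0] := @expRN_small _ (1 / 4) (1 / 4) ltac:(lra) ltac:(lra).
exists x0 => x xx0; set t := expR (- (x / 4)).
have tE : t = expR (- (1 / 4 * x)) by congr expR; lra.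
have t0 : 0 < t := expR_gt0 _.
have t4 : t <= 1 / 4 by rewrite tE; exact: Hx0.
have x_ge0 : 0 <= x := le_trans x00 xx0.
pose r := expR (3 / 4 * x).
have e4 : expR (- (4 * t)) <= 1 - 2 * t.
  have h1 := expR_ge1Dx (4 * t); have h2 := expR_gt0 (- (4 * t)).
  have : expR (- (4 * t)) * (1 + 4 * t) <= 1.
    by apply: (le_trans (ler_wpM2l (ltW h2) h1)); rewrite -expRD addNr expR0.
  clearbody t; nra.
have vru : expR (x - 4 * t) + r + 1 <= expR x.
  have rE : r = expR x * t by rewrite /r /t -expRD; congr expR; lra.
  have oneE : 1 <= expR x * t by rewrite -rE; apply: le_trans (expR_ge1Dx _); lra.
  have := ler_wpM2l (expR_ge0 x) e4; rewrite -expRD rE; clearbody t; lra.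
have B0 : 0 <= (K1 / m) ^+ 2 * expR (- (3 / 2 * p * x)) by rewrite mulr_ge0// expR_ge0.
have bound k : (0 < k)%N -> k%:R ^+ 2 * g (r / k%:R) ^+ 2 <=
    k%:R ^+ (n + 2) * ((K1 / m) ^+ 2 * expR (- (3 / 2 * p * x))).
  move=> k0; have kpos : 0 < k%:R :> R by rewrite ltr0n.
  have := gK (3 / 4 * x - ln k%:R); rewrite -expR_div// -/r => gk.
  have g0 := branch_tail_ge0 nu P W (r / k%:R).
  have := ler_pM g0 g0 gk gk; rewrite -!expr2 => g2.
  rewrite exprD -[leRHS]mulrA [leRHS]mulrCA ler_wpM2l ?sqr_ge0//.
  apply: le_trans g2 _; rewrite [leLHS]exprMn [leRHS]mulrCA ler_wpM2l//.
  rewrite [leLHS]expr2 -expRD.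
  apply: (@le_trans _ _ (expR (2 * p * ln k%:R) * expR (- (3 / 2 * p * x)))).
    by rewrite -expRD ler_expR; lra.
  by rewrite ler_wpM2r ?expR_ge0// kn.
have := @tail_upper _ _ nu htail P HP _ _ mW mW (@weight_rec R) (expR x)
  (expR (x - 4 * t)) r _ (n + 2) (expR_ge0 _) (expR_ge0 _) vru B0 bound.
move=> H; have := ler_wpM2l (expR_ge0 (chi * x)) H; rewrite -/(f x) => /le_trans; apply.
rewrite mulrDr; apply: lerD.
  rewrite /F mulrA -expRD le_eqVlt; apply/orP; left; apply/eqP.
  by congr (expR _ * _); ring.
rewrite le_eqVlt; apply/orP; left; apply/eqP.
rewrite mulrCA -[RHS]mulrA; congr (_ * _); rewrite mulrCA; congr (_ * _).
by rewrite -expRD; congr expR; rewrite /p; ring.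
Qed.

Lemma weight_renewal_pair :
  renewal_pair chi (ln q) (ln Q) [set ln y | y in msupport nu] f F.
Proof.
split.
- exact: chi0.
- by rewrite ln_gt0.
- have Qp : 0 < Q by apply: supp_gt0; exact: ltW.
  by rewrite ler_ln ?posrE ?(ltW qQ)// supp_gt0.
- exact: scaled_tail_gt0.
- by move=> x; rewrite -[leRHS]mulr1 ler_wpM2l ?expR_ge0// tail_le1.
- move=> x y xy; rewrite /f mulrA -expRD mulrBr subrK.
  by rewrite ler_wpM2l ?expR_ge0// tail_noninc// ler_expR.
- exact: scaled_branch_tail_le.
- exact: scaled_branch_tail_ge.
- exact: scaled_branch_tail_supp.
- exact: scaled_tail_lower.
- exact: scaled_tail_upper.
- have [K [p [p0 pchi K0 HK]]] := tail_init q1 chi0 m0 htail nu_supp hchi HP.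
  exists K, (chi - p); split; first by rewrite subr_ge0 pchi ltrBlDr ltrDl.
  move=> x _; rewrite /f mulrBl expRD mulrCA ler_wpM2l ?expR_ge0//.
Qed.

End weight_renewal.

(** * The asymptotics of the weight *)

Lemma realizes_law (R : realType) (h : probability nat R) (nu : probability R R)
    d (Omega : measurableType d) (P : probability Omega R) (X : Omega -> config R)
    (H : realizes h nu P X) : realizes h nu (config_law P (realizes_measurable H)) id.
Proof.
split.
- by move=> i E; exact: coord_event_measurable.
- by move=> v B; exact: realizes_offspring H v B.
- by move=> e B mB; exact: realizes_bias H e B mB.
- by move=> s E us sE; have := realizes_indep H us sE; exact.
Qed.

(** The biases are almost surely positive, so taking their absolute values in
    [weight] changes nothing. *)
Lemma tree_weight_law (R : realType) (h : probability nat R) (nu : probability R R)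
    (P0 : probability (config R) R) d (Omega : measurableType d)
    (P : probability Omega R) (N : vertex -> {RV P >-> nat})
    (beta : edge -> {RV P >-> R}) (u : R) :
  nu [set y : R | 1 < y] = 1%E ->
  realizes h nu P0 id -> weighted_GW h nu N beta ->
  P [set w | (u%:E < tree_weight (fun v => N v w) (fun e => beta e w))%E] =
  P0 [set x | (u%:E < weight x)%E].
Proof.
move=> nu1 H0 H; have HX := weighted_GW_realizes H; set X := fun w => _ in HX.
have mX := realizes_measurable HX.
have mWu := measurable_egt u%:E (@measurable_weight R).
rewrite -[RHS](realizes_unique HX H0 mWu).
set A := [set w | _]; set B := X @^-1` _.
have mA : measurable A.
  have := measurable_egt u%:E (measurable_tree_weight (phi := id) (@measurable_id _ R setT)).
  move=> mT; have := mX measurableT _ mT; rewrite setTI.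
  exact.
have mB : measurable B by rewrite -[B]setTI; exact: mX.
pose Z (n : nat) : set Omega := match unpickle n with
  | Some e => beta e @^-1` (~` [set y : R | 1 < y]) | None => set0 end.
have m1 : measurable [set y : R | 1 < y].
  rewrite (_ : [set y | _] = `]1, +oo[%classic)//.
  by apply/seteqP; split => y /=; rewrite in_itv/= andbT.
have mZ n : measurable (Z n).
  rewrite /Z; case: unpickle => [e|]; last exact: measurable0.
  by rewrite -[X in measurable X]setTI; apply: measurable_funPT => //; exact: measurableC.
have Z0 n : P (Z n) = 0%E.
  rewrite /Z; case: unpickle => [e|]; last exact: measure0.
  have -> : P (beta e @^-1` (~` [set y : R | 1 < y])) = nu (~` [set y : R | 1 < y]).
    by apply: (weighted_GW_bias H); exact: measurableC.
  by rewrite probability_setC// nu1 subee.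
pose U := \bigcup_n Z n.
have mU : measurable U by exact: bigcupT_measurable.
have U0 : P U = 0%E.
  apply/negligibleP => //; apply: negligible_bigcup => n.
  by apply/negligibleP; [exact: mZ|exact: Z0].
have drop C : measurable C -> P C = P (C `\` U).
  move=> mC; have e : P C = (P (C `\` U) + P (C `&` U))%E by exact: measureDI.
  rewrite e (_ : P (C `&` U) = 0%E) ?adde0//.
  apply/eqP; rewrite eq_le measure_ge0 andbT -U0; apply: le_measure.
  - by rewrite inE; exact: measurableI.
  - by rewrite inE.
  - by move=> w [].
rewrite (drop _ mA) (drop _ mB); congr (P _).
suff E w : ~ U w -> weight (X w) = tree_weight (fun v => N v w) (fun e => beta e w).
  by apply/seteqP; split => w [Cw Uw]; split => //; move: Cw; rewrite /A /B /= E.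
move=> Uw; rewrite /weight /X /=; congr tree_weight; apply/funext => e.
have b1 : 1 < beta e w.
  have [n nE] : exists n, unpickle n = Some e by exists (pickle e); exact: pickleK.
  by apply: contrapT => be; apply: Uw; exists n => //; rewrite /Z nE.
by rewrite gtr0_norm// (lt_trans ltr01 b1).
Qed.

Lemma asymp_of_scaled (R : realType) (chi l : R) (G : R -> R) : 0 < l ->
  expR (chi * x) * G (expR x) @[x --> +oo] --> l ->
  asymp_equiv G (fun u => l * u `^ (- chi)).
Proof.
move=> l0 Gl; rewrite /asymp_equiv; apply/cvgrPdist_le => e e0.
have el0 : 0 < e * l by rewrite mulr_gt0.
move/cvgrPdist_le : Gl => /(_ _ el0)[M [_ HM]].
exists (expR M); split; first by rewrite num_real.
move=> u Mu; have u0 : 0 < u := lt_trans (expR_gt0 M) Mu.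
have := HM (ln u); rewrite -ltr_expR lnK ?posrE// => /(_ Mu).
have uc : 0 < u `^ (- chi) by exact: powR_gt0.
have -> : expR (chi * ln u) = (u `^ (- chi))^-1.
  by rewrite -powRN opprK /powR gt_eqF.
have -> : l - (u `^ (- chi))^-1 * G u = l * (1 - G u / (l * u `^ (- chi))).
  by field; rewrite !lt0r_neq0.
by rewrite normrM (gtr0_norm l0) mulrC ler_pM2r.
Qed.

Theorem theorem2 (R : realType)
  (h : probability nat R)
  (hmean : (0 < offspring_mean h < 1)%E)
  (htail : exists2 c : R, 0 < c &
     forall k : nat,
       (\sum_(k <= l <oo) h [set l] <= (expR (- (c * k%:R)))%:E)%E)
  (nu : probability R R)
  (nu_gt1 : nu [set y : R | 1 < y] = 1%E)
  (q Q : R) (hq : 1 < q) (hqQ : q < Q)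
  (nu_supp : msupport nu `<=` [set y | q <= y <= Q])
  (nu_span : dense (int_span [set ln y | y in msupport nu]))
  (chi : R) (chi_gt0 : 0 < chi)
  (hchi : (\int[nu]_(y in [set y : R | (1 < y)%R]) (y `^ chi)%:E
           = (offspring_mean h)^-1)%E) :
  exists2 d1 : R, 0 < d1 &
    forall (d : measure_display) (Omega : measurableType d)
      (P : probability Omega R)
      (N : vertex -> {RV P >-> nat}) (beta : edge -> {RV P >-> R}),
      weighted_GW h nu N beta ->
      asymp_equiv
        (fun u => fine (P [set w |
           (u%:E < tree_weight (fun v => N v w) (fun e => beta e w))%E]))
        (fun u => d1 * u `^ (- chi)).
Proof.
rewrite (offspring_meanE htail) in hmean hchi.
have m0 : 0 < moment h 1 by case/andP: hmean; rewrite lte_fin.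
rewrite inver gt_eqF// in hchi.
(* the limit is read off from one realization; if there is none, the statement
   is empty *)
have [[P0 H0]|noP0] := pselect (exists P0 : probability (config R) R, realizes h nu P0 id).
  have pair := weight_renewal_pair hq hqQ chi_gt0 m0 htail nu_supp hchi H0.
  have A_gt0 s : [set ln y | y in msupport nu] s -> 0 < s.
    by move=> [y /nu_supp/andP[qy _] <-]; rewrite ln_gt0// (lt_le_trans hq).
  have [l l0 fl] := renewal_limit pair A_gt0 nu_span.
  exists l => // d Omega P N beta H.
  have -> : (fun u => fine (P [set w |
      (u%:E < tree_weight (fun v => N v w) (fun e => beta e w))%E])) =
      tail_prob P0 (@weight R).
    by apply/funext => u; rewrite (tree_weight_law u nu_gt1 H0 H).
  exact: asymp_of_scaled.
exists 1 => // d Omega P N beta H; exfalso; apply: noP0.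
by eexists; exact: realizes_law (weighted_GW_realizes H).
Qed.
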